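(* There exists a real number $c(q)>0$ (depending only on $q$) such that the following holds. Let $f$ be a non-zero Drinfeld quasi-modular form for $\Gamma=\mathbf{GL}_2(A)$ of weight $w$ and depth $l\ge 1$. Then $$\nu_{\infty}(f)\leq c(q)\, l\,(w-l)\max\{1,\log_q(w-l)\}.$$ Moreover, one can take $c(q)=252\,q(q^2-1)$.
   Context: Let $q=p^e$ be a power of a prime $p$ with $e\ge 1$, $\mathbb{F}_q$ the field with $q$ elements, $A=\mathbb{F}_q[\theta]$ with $\theta$ an indeterminate, $K=\mathbb{F}_q(\theta)$, $|\cdot|$ the absolute value on $K$ with $|x|=q^{\deg_\theta x}$, $K_\infty=\mathbb{F}_q((1/\theta))$ the completion of $K$, and $C$ the completion of an algebraic closure of $K_\infty$ for the unique extension of $|\cdot|$. Let $\Omega=C\setminus K_\infty$ (a rigid analytic space) and $\Gamma=\mathbf{GL}_2(A)$ (matrices with entries in $A$ and determinant in $\mathbb{F}_q^*$), acting on $\Omega$ by $\gamma(z)=\frac{az+b}{cz+d}$ for $\gamma=\begin{pmatrix}a&b\\c&d\end{pmatrix}$. Let $e_{\mathrm{Car}}(z)=\sum_{i\ge0} z^{q^i}/d_i$ be the Carlitz exponential, where $d_0=1$, $d_i=[i][i-1]^q\cdots[1]^{q^{i-1}}$, $[i]=\theta^{q^i}-\theta$; fix $\tilde\pi\in C$ with $\ker e_{\mathrm{Car}}=\tilde\pi A$. The parameter at infinity is $u=u(z)=1/e_{\mathrm{Car}}(\tilde\pi z)$ for $z\in\Omega$. A function $f:\Omega\to C$ is holomorphic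 on $\Omega$ if it is rigid analytic. It is holomorphic at infinity if $f(z+a)=f(z)$ for all $z\in\Omega$, $a\in A$, and there is $\epsilon>0$ such that for all $z\in\Omega$ with $|u(z)|<\epsilon$, $f(z)$ is the sum of a convergent series $\sum_{n\ge0}f_nu(z)^n$ with $f_n\in C$. Let $w\ge0$ be an integer and $m\in\mathbb{Z}/(q-1)\mathbb{Z}$. A holomorphic function $f:\Omega\to C$ is a quasi-modular form of weight $w$ and type $m$ if there exist $A$-periodic functions $f_0,\dots,f_l$, holomorphic on $\Omega$ and at infinity, such that for all $z\in\Omega$ and $\gamma=\begin{pmatrix}a&b\\c&d\end{pmatrix}\in\Gamma$, $$f(\gamma(z))=(cz+d)^w(\det\gamma)^{-m}\sum_{i=0}^l f_i(z)\Bigl(\frac{c}{cz+d}\Bigr)^i.$$ The functions $f_i$ are uniquely determined by $f$, and $f_0=f$; if $f\ne0$, then $w$ and $m$ are uniquely determined, one can take $f_l\ne0$, and $l$ is then called the depth of $f$. For a non-zero quasi-modular form $f$ with $u$-expansion $f=\sum_{n\ge0}f_nu^n$ (for $|u(z)|$ small), its vanishing order at infinity is $\nu_\infty(f)=\min\{n\mid f_n\neq0\}$. $\log_q$ is the real logarithm in base $q$. *)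

(* Defs.v *)
From HB Require Import structures.
From mathcomp Require Import all_boot all_order all_algebra.
From mathcomp Require Import all_classical all_reals all_analysis.
Set Implicit Arguments.
Unset Strict Implicit.
Unset Printing Implicit Defensive.
Import Order.TTheory GRing.Theory Num.Theory.
Import numFieldNormedType.Exports.
Local Open Scope classical_set_scope.
Local Open Scope ring_scope.

(* A = F[theta] is {poly F} with theta = 'X, and K is {fraction {poly F}}. *)

(* |x| = q ^ (deg x) on K; the difference of sizes of a numerator and a
   denominator is the difference of their degrees. *)
Definition absK (R : realType) (F : finFieldType) (x : {fraction {poly F}}) : R :=
  if x == 0 then 0
  else (#|F|%:R : R) ^ ((size (frac (repr x)).1)%:Z - (size (frac (repr x)).2)%:Z).

Section ValuedField.
Variables (R : realType) (F : finFieldType) (C : closedFieldType).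
Variables (iota : {rmorphism {fraction {poly F}} -> C}) (abs : C -> R).

Definition vcvg (s : nat -> C) (y : C) : Prop :=
  (fun n => abs (s n - y)) @ \oo --> (0 : R).

Definition vcauchy (s : nat -> C) : Prop :=
  forall eps : R, 0 < eps -> exists N : nat, forall m n : nat,
    (N <= m)%N -> (N <= n)%N -> abs (s m - s n) < eps.

(* K_oo is realised as the topological closure of K in C; C being complete,
   this is the completion of K. *)
Definition Kinf : set C :=
  [set x | forall eps : R, 0 < eps ->
     exists y : {fraction {poly F}}, abs (x - iota y) < eps].

Definition algebraic_over_Kinf : set C :=
  [set x | exists P : {poly C},
     [/\ P != 0, forall i : nat, Kinf P`_i & root P x]].

(* These properties characterise C, with its embedding of K and its absolute
   value, up to isometric isomorphism over K: C is an algebraically closed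
   (closedFieldType) complete ultrametric extension of K in which the algebraic
   closure of K_oo is dense. *)
Record is_completed_closure : Prop := {
  abs_ge0 : forall x : C, 0 <= abs x;
  abs_eq0 : forall x : C, abs x = 0 <-> x = 0;
  absM : forall x y : C, abs (x * y) = abs x * abs y;
  abs_ultra : forall x y : C, abs (x + y) <= Num.max (abs x) (abs y);
  abs_iota : forall x : {fraction {poly F}}, abs (iota x) = absK R x;
  abs_complete : forall s : nat -> C, vcauchy s -> exists y : C, vcvg s y;
  abs_dense : forall (x : C) (eps : R), 0 < eps ->
    exists2 y : C, algebraic_over_Kinf y & abs (x - y) < eps
}.

Definition inA (a : {poly F}) : C := iota (FracField.tofrac a).

Definition Omega : set C := ~` Kinf.

(* The admissible covering of Omega by affinoids
   {z | |z| <= q^n, |z - x| >= q^-n for all x in K_oo}. *)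
Definition Omega_affinoid (n : nat) : set C :=
  [set z | abs z <= #|F|%:R ^+ n /\
           forall x : C, Kinf x -> #|F|%:R ^- n <= abs (z - x)].

(* The ring of analytic functions on an affinoid subset X of the line is the
   uniform closure of the rational functions without poles in X; a function on
   Omega is rigid analytic iff it is analytic on each Omega_affinoid n.
   Functions on Omega are represented by total functions on C, whose values
   outside Omega are irrelevant. *)
Definition holomorphic_Omega (f : C -> C) : Prop :=
  forall (n : nat) (eps : R), 0 < eps ->
    exists P Q : {poly C}, forall z : C, Omega_affinoid n z ->
      ~~ root Q z /\ abs (f z - P.[z] / Q.[z]) < eps.

(* [i] and d_i = [i] [i-1]^q ... [1]^(q^(i-1)) *)
Definition carlitz_bracket (i : nat) : {poly F} := 'X^(#|F| ^ i) - 'X.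

Definition carlitz_d (i : nat) : {poly F} :=
  \prod_(j < i) carlitz_bracket (i - j) ^+ (#|F| ^ j).

(* The limit of s, with junk value 0 if s does not converge. *)
Definition vlim (s : nat -> C) : C := xget 0 [set y | vcvg s y].

Definition carlitz_exp (z : C) : C :=
  vlim (fun n => \sum_(i < n) z ^+ (#|F| ^ i) / inA (carlitz_d i)).

Definition is_carlitz_period (varpi : C) : Prop :=
  forall z : C, carlitz_exp z = 0 <-> exists a : {poly F}, z = varpi * inA a.

Definition uparam (varpi z : C) : C := (carlitz_exp (varpi * z))^-1.

Definition A_periodic (f : C -> C) : Prop :=
  forall (z : C) (a : {poly F}), Omega z -> f (z + inA a) = f z.

Definition u_expansion (varpi : C) (f : C -> C) (a : nat -> C) : Prop :=
  exists2 eps : R, 0 < eps & forall z : C, Omega z -> abs (uparam varpi z) < eps ->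
    vcvg (fun n => \sum_(i < n) a i * uparam varpi z ^+ i) (f z).

Definition holomorphic_infty (varpi : C) (f : C -> C) : Prop :=
  A_periodic f /\ exists a : nat -> C, u_expansion varpi f a.

Definition nonzero_on_Omega (f : C -> C) : Prop := exists2 z, Omega z & f z != 0.

(* GL_2(A) is the set of matrices in unitmx, as the units of A are F_q^*. As
   (\det g)^(q-1) = 1, the condition only depends on m modulo q - 1. *)
Definition quasi_modular_data (varpi : C) (w : nat) (m : int) (f : C -> C)
    (l : nat) (fs : 'I_l.+1 -> C -> C) : Prop :=
  [/\ holomorphic_Omega f,
      forall i : 'I_l.+1, [/\ A_periodic (fs i), holomorphic_Omega (fs i)
                            & holomorphic_infty varpi (fs i)]
    & forall (z : C) (g : 'M[{poly F}]_2), Omega z -> g \in unitmx ->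
        let a := inA (g 0 0) in let b := inA (g 0 1) in
        let c := inA (g 1 0) in let d := inA (g 1 1) in
        f ((a * z + b) / (c * z + d)) =
          (c * z + d) ^+ w * inA (\det g) ^ (- m) *
          \sum_(i < l.+1) fs i z * (c / (c * z + d)) ^+ i].

Definition quasi_modular_of_depth (varpi : C) (w : nat) (m : int) (l : nat)
    (f : C -> C) : Prop :=
  exists2 fs : 'I_l.+1 -> C -> C,
    quasi_modular_data varpi w m f fs & nonzero_on_Omega (fs ord_max).

Definition is_vanishing_order (a : nat -> C) (n : nat) : Prop :=
  a n != 0 /\ forall i : nat, (i < n)%N -> a i = 0.

End ValuedField.

(* The logarithm in base q of w - l is ln (w - l) / ln q; when w = l the junk
   value ln 0 = 0 agrees with the convention max {1, log_q 0} = 1. *)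
Definition vanishing_bound (R : realType) (q : nat) (c : R) : Prop :=
  forall (F : finFieldType), #|F| = q ->
  forall (C : closedFieldType) (iota : {rmorphism {fraction {poly F}} -> C})
         (abs : C -> R), is_completed_closure iota abs ->
  forall varpi : C, is_carlitz_period iota abs varpi ->
  forall (w : nat) (m : int) (l : nat) (f : C -> C), (1 <= l)%N ->
    nonzero_on_Omega iota abs f ->
    quasi_modular_of_depth iota abs varpi w m l f ->
  forall a : nat -> C, u_expansion iota abs varpi f a ->
    exists2 n : nat, is_vanishing_order a n &
      n%:R <= c * l%:R * (w%:R - l%:R) * Num.max 1 (ln (w%:R - l%:R) / ln q%:R).

(* Main.v *)
Require Import Defs.
From mathcomp Require Import all_boot all_order all_algebra.
From mathcomp Require Import all_classical all_reals all_analysis.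
From mathcomp Require Import pgroup abelian finfield qpoly.
From mathcomp Require Import ring lra zify.
Set Implicit Arguments.
Unset Strict Implicit.
Unset Printing Implicit Defensive.
Import Order.TTheory GRing.Theory Num.Theory.
Local Open Scope ring_scope.

(** Idea. Over each vertex of the Bruhat-Tits tree of K_oo lies a "Shilov" set of
    points of Omega; for a holomorphic f let phi be the log_q of the sup of |f| on
    it, truncated below by a small constant. Since log |z - c| is subharmonic on
    the tree, so is phi. A periodic function bounded at infinity is largest at
    the standard vertex of its ray to infinity; applied to the coefficients f_i,
    and combined with the reduction of Omega modulo SL_2(A), this gives
    |f| <= q^(w k) M at level k, where M = max_i sup |f_i| over the standard vertex.
    Lagrange interpolation of sum_i f_i(z) T^(l - i) at l + 1 nodes z + d/c with
    (c, d) coprime, deg c = n and q^(2n) of the order of l, produces a vertex at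
    level 2n where this majorant is almost attained. The gap between majorant and
    phi is nonnegative and nearly superharmonic, so Harnack's inequality
    along the path of length 2n bounds the gap at the standard vertex. Finally phi
    is convex in a geometric scale along the ray to infinity, whereas a zero of order nu
    forces it to decrease like -nu q^(n+1)/(q-1), so that nu is at most the gap
    plus w. *)

Section ValuedFieldTheory.
Variables (R : realType) (F : finFieldType) (C : closedFieldType).
Variables (iota : {rmorphism {fraction {poly F}} -> C}) (abs : C -> R).
Hypothesis HC : is_completed_closure iota abs.
Local Notation K := {fraction {poly F}}.
Local Notation Q := (#|F|%:R : R).
Local Notation inA := (inA iota).

Let a_ge0 := abs_ge0 HC.
Let a_M := absM HC.
Let a_ultra := abs_ultra HC.

(** * The absolute value on K and C *)

Lemma abs0 : abs 0 = 0.
Proof. exact/(abs_eq0 HC). Qed.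

Lemma abs_eq0b x : (abs x == 0) = (x == 0).
Proof. by apply/eqP/eqP => /(abs_eq0 HC). Qed.

Lemma abs_gt0 x : (0 < abs x) = (x != 0).
Proof. by rewrite lt_def abs_eq0b a_ge0 andbT. Qed.

Lemma abs1 : abs 1 = 1.
Proof.
have h : abs 1 != 0 by rewrite abs_eq0b oner_eq0.
by apply: (mulfI h); rewrite -a_M !mulr1.
Qed.

Lemma absX x n : abs (x ^+ n) = abs x ^+ n.
Proof. by elim: n => [|n IHn]; rewrite ?expr0 ?abs1 // !exprS a_M IHn. Qed.

Lemma absN x : abs (- x) = abs x.
Proof.
have h : abs (-1) = 1.
  apply/eqP; rewrite -(@pexpr_eq1 _ _ 2%N) ?a_ge0 //.
  by rewrite -absX sqrrN expr1n abs1.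
by rewrite -mulN1r a_M h mul1r.
Qed.

Lemma absV x : abs x^-1 = (abs x)^-1.
Proof.
have [->|x0] := eqVneq x 0; first by rewrite invr0 abs0 invr0.
have h : abs x != 0 by rewrite abs_eq0b.
by apply: (mulfI h); rewrite -a_M !mulfV // abs1.
Qed.

Lemma abs_div x y : abs (x / y) = abs x / abs y.
Proof. by rewrite a_M absV. Qed.

Lemma absXz x (k : int) : abs (x ^ k) = abs x ^ k.
Proof. by case: k => n; rewrite ?absX // /exprz absV absX. Qed.

Lemma abs_distC x y : abs (x - y) = abs (y - x).
Proof. by rewrite -absN opprB. Qed.

Lemma abs_prod (I : Type) (r : seq I) (P : pred I) (f : I -> C) :
  abs (\prod_(i <- r | P i) f i) = \prod_(i <- r | P i) abs (f i).
Proof. exact: (big_morph abs a_M abs1). Qed.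

Lemma ultraD x y (B : R) : abs x <= B -> abs y <= B -> abs (x + y) <= B.
Proof. by move=> hx hy; apply: le_trans (a_ultra _ _) _; rewrite ge_max hx. Qed.

Lemma ultraB x y (B : R) : abs x <= B -> abs y <= B -> abs (x - y) <= B.
Proof. by move=> hx hy; apply: ultraD; rewrite ?absN. Qed.

Lemma ultraD_lt x y (B : R) : abs x < B -> abs y < B -> abs (x + y) < B.
Proof. by move=> hx hy; apply: le_lt_trans (a_ultra _ _) _; rewrite gt_max hx. Qed.

Lemma ultraB_lt x y (B : R) : abs x < B -> abs y < B -> abs (x - y) < B.
Proof. by move=> hx hy; apply: ultraD_lt; rewrite ?absN. Qed.

Lemma ultra_sum (I : Type) (r : seq I) (P : pred I) (f : I -> C) (B : R) :
  0 <= B -> (forall i, P i -> abs (f i) <= B) ->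
  abs (\sum_(i <- r | P i) f i) <= B.
Proof.
move=> B0 h; elim/big_rec: _ => [|i x Pi hx]; first by rewrite abs0.
by apply: ultraD => //; apply: h.
Qed.

Lemma abs_dom x y : abs y < abs x -> abs (x + y) = abs x.
Proof.
move=> yx; apply/le_anti/andP; split; first by apply: ultraD => //; apply: ltW.
rewrite leNgt; apply/negP => h.
have : abs (x + y - y) < abs x by apply: ultraB_lt.
by rewrite addrK ltxx.
Qed.

Lemma abs_domB x y : abs y < abs x -> abs (x - y) = abs x.
Proof. by move=> h; apply: abs_dom; rewrite absN. Qed.

Lemma card_gt1 : (1 < #|F|)%N.
Proof. exact: card_finNzRing_gt1. Qed.

Lemma Q_gt1 : 1 < Q. Proof. by rewrite ltr1n card_gt1. Qed.

Lemma Q_gt0 : 0 < Q. Proof. by apply: lt_trans Q_gt1. Qed.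

Lemma Q_ge0 : 0 <= Q. Proof. exact: ltW Q_gt0. Qed.

Lemma Q_neq0 : Q != 0. Proof. by rewrite gt_eqF ?Q_gt0. Qed.

Lemma Qz_gt0 (m : int) : 0 < Q ^ m. Proof. by rewrite exprz_gt0 ?Q_gt0. Qed.

Lemma Qz_ge0 (m : int) : 0 <= Q ^ m. Proof. exact: ltW (Qz_gt0 m). Qed.

Lemma Qz_le (m n : int) : (Q ^ m <= Q ^ n) = (m <= n).
Proof. by rewrite ler_eXz2l ?Q_gt1. Qed.

Lemma Qz_lt (m n : int) : (Q ^ m < Q ^ n) = (m < n).
Proof. by rewrite ltr_eXz2l ?Q_gt1. Qed.

Lemma inA_D a b : inA (a + b) = inA a + inA b.
Proof. by rewrite /Defs.inA !rmorphD. Qed.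

Lemma inA_M a b : inA (a * b) = inA a * inA b.
Proof. by rewrite /Defs.inA !rmorphM. Qed.

Lemma inA_N a : inA (- a) = - inA a.
Proof. by rewrite /Defs.inA !rmorphN. Qed.

Lemma inA_B a b : inA (a - b) = inA a - inA b.
Proof. by rewrite /Defs.inA !rmorphB. Qed.

Lemma inA0 : inA 0 = 0. Proof. by rewrite /Defs.inA !rmorph0. Qed.

Lemma inA1 : inA 1 = 1. Proof. by rewrite /Defs.inA !rmorph1. Qed.

Lemma inA_X a n : inA (a ^+ n) = inA a ^+ n.
Proof. by rewrite /Defs.inA !rmorphXn. Qed.

Lemma inA_prod (I : Type) (r : seq I) (f : I -> {poly F}) :
  inA (\prod_(i <- r) f i) = \prod_(i <- r) inA (f i).
Proof. exact: (big_morph inA inA_M inA1). Qed.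

Lemma inA_eq0 a : (inA a == 0) = (a == 0).
Proof. by rewrite /Defs.inA fmorph_eq0 tofrac_eq0. Qed.

Lemma frac_numden (x : K) :
  x = FracField.tofrac (frac (repr x)).1 / FracField.tofrac (frac (repr x)).2.
Proof.
have d0 : FracField.tofrac (frac (repr x)).2 != 0 by rewrite tofrac_eq0 denom_ratioP.
apply: (mulIf d0); rewrite divfK //.
rewrite -{1}[x]reprK; move: (repr x) => r {d0}.
rewrite /FracField.tofrac; unlock; rewrite -[LHS]FracField.pi_mul.
apply/eqmodP; rewrite /= FracField.equivfE /FracField.mulf.
rewrite !numden_Ratio ?mulf_neq0 ?oner_eq0 ?denom_ratioP //.
by rewrite !mulr1 mulrC.
Qed.

Lemma absK_poly (a : {poly F}) : a != 0 ->
  absK R (FracField.tofrac a) = Q ^+ (size a).-1.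
Proof.
move=> a0; rewrite /absK tofrac_eq0 (negPf a0).
have d0 : (frac (repr (FracField.tofrac a))).2 != 0 by exact: denom_ratioP.
have E : (frac (repr (FracField.tofrac a))).1 = a * (frac (repr (FracField.tofrac a))).2.
  apply/eqP; rewrite -tofrac_eq tofracM; apply/eqP.
  rewrite {2}(frac_numden (FracField.tofrac a)) divfK // tofrac_eq0 //.
rewrite E size_mul // exprnP; congr (Q ^ _).
move: (frac _).2 d0 => d d0.
move: a0 d0; rewrite -!size_poly_gt0.
by move: (size a) (size d) => u v; lia.
Qed.

Lemma abs_inA a : a != 0 -> abs (inA a) = Q ^+ (size a).-1.
Proof. by move=> a0; rewrite /Defs.inA (abs_iota HC) absK_poly. Qed.

Lemma inA_ge1 a : a != 0 -> 1 <= abs (inA a).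
Proof. by move=> a0; rewrite abs_inA // exprn_ege1 // ltW ?Q_gt1. Qed.

Lemma iota_numden (x : K) : exists a b : {poly F}, b != 0 /\ iota x = inA a / inA b.
Proof.
exists (frac (repr x)).1, (frac (repr x)).2.
split; first exact: denom_ratioP.
by have := congr1 iota (frac_numden x); rewrite rmorphM fmorphV.
Qed.

Lemma iota_val (x : K) : x != 0 -> exists k : int, abs (iota x) = Q ^ k.
Proof.
have [a [b [b0 E]]] := iota_numden x => x0.
have a0 : a != 0.
  apply/eqP => a0; move: x0; rewrite -(fmorph_eq0 iota) E a0 inA0 mul0r.
  by rewrite eqxx.
rewrite E abs_div !abs_inA //; exists ((size a).-1%:Z - (size b).-1%:Z).
by rewrite expfzDr ?Q_neq0 // -exprnN.
Qed.

Lemma iota_round (x : K) : exists a, abs (iota x - inA a) < 1.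
Proof.
have [a [b [b0 E]]] := iota_numden x.
exists (a %/ b); rewrite E {1}(divp_eq a b) inA_D inA_M.
have ib0 : inA b != 0 by rewrite inA_eq0.
rewrite mulrDl mulfK // addrC addKr abs_div.
have [->|r0] := eqVneq (a %% b) 0.
  by rewrite inA0 abs0 mul0r.
rewrite ltr_pdivrMr ?abs_gt0 // mul1r !abs_inA // ltr_eXn2l ?Q_gt1 //.
have := ltn_modp a b; rewrite b0; move: r0 b0; rewrite -!size_poly_gt0.
by move: (size (a %% b)) (size b) => u v; lia.
Qed.

Lemma iota_residue (x : K) : abs (iota x) <= 1 ->
  exists b : F, abs (iota x - inA b%:P) < 1.
Proof.
move=> x1; have [a ha] := iota_round x.
suff [b ab] : exists b, a = b%:P by exists b; rewrite -ab.
have a1 : abs (inA a) <= 1.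
  by rewrite -[inA a](subKr (iota x)); apply: ultraB => //; apply: ltW.
exists a`_0; apply: size1_polyC; rewrite leqNgt; apply/negP => s1.
have a0 : a != 0 by rewrite -size_poly_gt0; lia.
move: a1; rewrite abs_inA // leNgt => /negP; apply.
by rewrite exprn_egt1 ?Q_gt1 //; lia.
Qed.

Lemma abs_const (b : F) : b != 0 -> abs (inA b%:P) = 1.
Proof. by move=> b0; rewrite abs_inA ?polyC_eq0 // size_polyC b0 expr0. Qed.

Lemma abs_const_le (b : F) : abs (inA b%:P) <= 1.
Proof.
have [->|b0] := eqVneq b 0; first by rewrite inA0 abs0 ler01.
by rewrite abs_const.
Qed.

Lemma abs_theta : abs (inA 'X) = Q.
Proof. by rewrite abs_inA ?polyX_eq0 // size_polyX expr1. Qed.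

(** * The tree: fibers over vertices *)

Definition unif (m : int) : K := FracField.tofrac 'X ^ (- m).
Definition cst (b : F) : K := FracField.tofrac b%:P.
Definition child (r : K) (m : int) (b : F) : K := r + cst b * unif m.

(* The pair (r, m) stands for the vertex of the tree given by the disc of center r
   and radius q^-m; its neighbours are (r, m - 1) and the (child r m b, m + 1).
   [fib r m] is the set of points of Omega whose image in the tree is that vertex. *)
Definition fib (r : K) (m : int) (z : C) : Prop :=
  abs (z - iota r) <= Q ^ (- m) /\ forall s : K, Q ^ (- m) <= abs (z - iota s).

Lemma abs_unif m : abs (iota (unif m)) = Q ^ (- m).
Proof. by rewrite /unif fmorphXz absXz -/(Defs.inA iota 'X) abs_theta. Qed.

Lemma abs_cst_le b : abs (iota (cst b)) <= 1.
Proof. exact: abs_const_le. Qed.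

Lemma abs_cst b : b != 0 -> abs (iota (cst b)) = 1.
Proof. exact: abs_const. Qed.

(* zeta is a root of 1 + prod (X - c), over 0 and the b in the unit disc, so that all
   the |zeta - c| <= 1 have product 1. *)
Lemma root_avoid (bs : seq C) : exists2 zeta : C, abs zeta <= 1 &
  forall b, b \in bs -> 1 <= abs (zeta - b).
Proof.
pose cs := 0 :: [seq b <- bs | abs b <= 1].
pose p := \prod_(c <- cs) ('X - c%:P) + 1 : {poly C}.
have sp : size p = (size cs).+1.
  by rewrite size_polyDl size_prod_XsubC ?size_poly1.
have /closed_rootP [z /rootP] : size p != 1%N by rewrite sp.
rewrite hornerD horner_prod hornerC => /eqP; rewrite addr_eq0 => /eqP pz.
have {}pz : \prod_(c <- cs) abs (z - c) = 1.
  rewrite -[RHS]abs1 -[RHS]absN -pz abs_prod.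
  by apply: eq_bigr => c _; rewrite hornerXsubC.
have cs1 c : c \in cs -> abs c <= 1.
  rewrite inE => /orP[/eqP -> |]; first by rewrite abs0 ler01.
  by rewrite mem_filter => /andP[].
have prod_gt1 : 1 < abs z -> forall t : seq C, (forall c, c \in t -> abs c <= 1) ->
    1 <= \prod_(c <- t) abs (z - c).
  move=> z1; elim=> [|c t IHt] ht; first by rewrite big_nil.
  rewrite big_cons mulr_ege1 ?IHt //; last first.
    by move=> d dt; apply: ht; rewrite inE dt orbT.
  have c1 : abs c < abs z by apply: le_lt_trans z1; apply: ht; rewrite inE eqxx.
  by rewrite abs_domB // ltW.
have z1 : abs z <= 1.
  rewrite leNgt; apply/negP => z1; move: pz; rewrite big_cons subr0 => pz.
  have : 1 < abs z * \prod_(c <- [seq b <- bs | abs b <= 1]) abs (z - c).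
    apply: (lt_le_trans z1); rewrite ler_peMr ?a_ge0 // prod_gt1 // => c hc.
    by apply: cs1; rewrite inE hc orbT.
  by rewrite pz ltxx.
exists z => // b bb.
have [b1|b1] := leP (abs b) 1; last by rewrite abs_distC abs_domB ?ltW // (le_lt_trans z1).
have bc : b \in cs by rewrite inE mem_filter b1 bb orbT.
have le1 c : c \in cs -> abs (z - c) <= 1 by move=> /cs1 c1; apply: ultraB.
rewrite -{1}pz (big_rem b) // -[leRHS]mulr1 ler_wpM2l //.
rewrite big_seq; apply: prodr_ile1 => c hc; rewrite a_ge0 le1 //.
exact: mem_rem hc.
Qed.

Lemma fib_avoid r m (bs : seq C) : exists2 z, fib r m z &
  forall b, b \in bs -> Q ^ (- m) <= abs (z - b).
Proof.
have u0 : iota (unif m) != 0 by rewrite -abs_gt0 abs_unif Qz_gt0.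
have [zeta z1 hz] := root_avoid
  ([seq (b - iota r) / iota (unif m) | b <- bs] ++
   [seq iota (cst b) | b <- enum F]).
have E (c : C) : abs (iota r + iota (unif m) * zeta - c) =
     Q ^ (- m) * abs (zeta - (c - iota r) / iota (unif m)).
  by rewrite -abs_unif -a_M mulrBr [_ * (_ / _)]mulrC divfK //; congr abs; ring.
exists (iota r + iota (unif m) * zeta); last first.
  move=> b bb; rewrite E ler_peMr ?Qz_ge0 //; apply: hz.
  by rewrite mem_cat (map_f (fun b => (b - iota r) / iota (unif m))).
split; first by rewrite addrC addKr a_M abs_unif ler_piMr // ltW ?Qz_gt0.
move=> s; rewrite E ler_peMr ?Qz_ge0 //.
have -> : (iota s - iota r) / iota (unif m) = iota ((s - r) / unif m).
  by rewrite rmorphM rmorphB fmorphV.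
have [t1|t1] := leP (abs (iota ((s - r) / unif m))) 1; last first.
  by rewrite abs_distC abs_domB ?ltW // (le_lt_trans z1).
have [b hb] := iota_residue t1.
have h1 : 1 <= abs (zeta - iota (cst b)).
  by apply: hz; rewrite mem_cat (map_f (fun b => iota (cst b))) ?orbT ?mem_enum.
rewrite -(subrK (iota (cst b)) zeta) -addrA abs_dom //.
by rewrite abs_distC (lt_le_trans _ h1).
Qed.

Lemma fib_nonempty r m : exists z, fib r m z.
Proof. by have [z] := fib_avoid r m [::]; exists z. Qed.

(* The supremum of |z - c| over [fib r m]. *)
Definition val r m c : R := Num.max (Q ^ (- m)) (abs (iota r - c)).

Lemma val_gt0 r m c : 0 < val r m c.
Proof. by rewrite lt_max Qz_gt0. Qed.

Lemma val_ge r m c : abs (iota r - c) <= val r m c.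
Proof. by rewrite le_max lexx orbT. Qed.

Lemma le_val r m c z : abs (z - iota r) <= Q ^ (- m) -> abs (z - c) <= val r m c.
Proof.
move=> h; rewrite -(subrK (iota r) z) -addrA.
by apply: ultraD; rewrite le_max ?h ?lexx ?orbT.
Qed.

Lemma eq_val r m c z : abs (z - iota r) <= Q ^ (- m) -> Q ^ (- m) <= abs (z - c) ->
  abs (z - c) = val r m c.
Proof.
move=> h hc; apply/le_anti; rewrite le_val //= ge_max hc /=.
rewrite -(subrKA z (iota r) (- c)); apply: ultraD => //.
by rewrite [X in X <= _]abs_distC (le_trans h).
Qed.

Lemma fib_abs r m z s : fib r m z ->
  abs (z - iota s) = Num.max (Q ^ (- m)) (abs (iota r - iota s)).
Proof. by case=> h hs; rewrite (@eq_val r m). Qed.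

(* [pole N] contains the complement of the affinoid of level N, where the denominators
   of the rational approximations have their roots. *)
Definition pole (N : int) (c : C) : Prop :=
  Q ^ N < abs c \/ exists s : K, abs (c - iota s) < Q ^ (- N).

Definition inside (N : int) (r : K) (m : int) : Prop :=
  [/\ m <= N, - m <= N & abs (iota r) <= Q ^ N].

Lemma fib_inside N r m z : inside N r m -> fib r m z -> abs z <= Q ^ N.
Proof.
move=> [_ mN rN] [h _]; rewrite -(subrK (iota r) z); apply: ultraD => //.
by rewrite (le_trans h) // Qz_le.
Qed.

Lemma pole_fib N r m c z : inside N r m -> pole N c -> fib r m z ->
  Q ^ (- m) <= abs (z - c).
Proof.
move=> iN pc fz; have zN := fib_inside iN fz.
case: iN => mN mN' rN; case: pc => [cN|[s cs]].
  by rewrite abs_distC abs_domB ?(le_lt_trans zN) // (le_trans _ (ltW cN)) // Qz_le.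
have h := fz.2 s; rewrite -(subrKA (iota s) z (- c)) abs_dom //.
by rewrite abs_distC (lt_le_trans cs) // (le_trans _ h) // Qz_le; lia.
Qed.

Lemma iota_disc (x : K) (m : int) : abs (iota x) < Q ^ m ->
  abs (iota x) <= Q ^ (m - 1).
Proof.
have [->|x0] := eqVneq x 0; first by rewrite rmorph0 abs0 ltW ?Qz_gt0.
by have [k ->] := iota_val x0; rewrite Qz_le Qz_lt; lia.
Qed.

Lemma abs_child_sub r m b : abs (iota (child r m b) - iota r) <= Q ^ (- m).
Proof.
rewrite /child rmorphD addrAC subrr add0r rmorphM a_M abs_unif.
by rewrite ler_piMl ?Qz_ge0 // abs_cst_le.
Qed.

Lemma abs_child_child r m b b' : b != b' ->
  abs (iota (child r m b) - iota (child r m b')) = Q ^ (- m).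
Proof.
move=> bb'; rewrite -rmorphB /child opprD addrACA subrr add0r -mulrBl.
rewrite rmorphM a_M abs_unif.
have -> : cst b - cst b' = cst (b - b') by rewrite /cst polyCB rmorphB.
by rewrite abs_cst ?mul1r // subr_eq0.
Qed.

Lemma Qz_pred m : Q ^ (- (m - 1)) = Q * Q ^ (- m).
Proof.
by rewrite opprB addrC expfzDr ?Q_neq0 // expr1z mulrC.
Qed.

Lemma Qz_succ m : Q ^ (- m) = Q * Q ^ (- (m + 1)).
Proof. by rewrite -Qz_pred addrK. Qed.

Lemma val_child_far r m b c : Q ^ (- m) < abs (iota r - c) ->
  val (child r m b) (m + 1) c = abs (iota r - c).
Proof.
move=> h; have E : abs (iota (child r m b) - c) = abs (iota r - c).
  rewrite -(subrKA (iota r) (iota (child r m b)) (- c)) addrC abs_dom //.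
  exact: le_lt_trans (abs_child_sub _ _ _) h.
by rewrite /val E; apply/max_idPr/(le_trans _ (ltW h)); rewrite Qz_le; lia.
Qed.

Lemma val_child_near r m c b0 : abs (iota (child r m b0) - c) < Q ^ (- m) ->
  forall b, b != b0 -> val (child r m b) (m + 1) c = Q ^ (- m).
Proof.
move=> h b bb0; have E : abs (iota (child r m b) - c) = Q ^ (- m).
  rewrite -(subrKA (iota (child r m b0)) (iota (child r m b)) (- c)).
  by rewrite abs_dom abs_child_child.
by rewrite /val E; apply/max_idPr; rewrite Qz_le; lia.
Qed.

Lemma prod_val_near r m c b0 : abs (iota (child r m b0) - c) < Q ^ (- m) ->
  \prod_(b : F) val (child r m b) (m + 1) c =
  val (child r m b0) (m + 1) c * (Q ^ (- m)) ^+ #|F|.-1.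
Proof.
move=> h; rewrite (bigD1 b0) //=; congr (_ * _).
rewrite (eq_bigr (fun=> Q ^ (- m))) => [|b]; last exact: val_child_near.
by rewrite prodr_const cardC1.
Qed.

Lemma card_pred : #|F| = #|F|.-1.+1.
Proof. by have := card_gt1; case: #|F|. Qed.

Lemma val_subharmonic r m c :
  val r m c ^+ #|F|.+1 <=
  val r (m - 1) c * \prod_(b : F) val (child r m b) (m + 1) c.
Proof.
have h0 := Qz_gt0 (- m).
have [A|A] := ltP (Q ^ (- m)) (abs (iota r - c)).
  rewrite (eq_bigr (fun=> abs (iota r - c))) => [|b _]; last exact: val_child_far.
  rewrite prodr_const exprS {1 2}/val (max_idPr (ltW A)).
  by rewrite ler_wpM2r ?exprn_ge0 ?val_ge.
have vE : val r m c = Q ^ (- m) by apply/max_idPl.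
have vP : val r (m - 1) c = Q * Q ^ (- m).
  rewrite -Qz_pred; apply/max_idPl/(le_trans A); rewrite Qz_le; lia.
rewrite vE vP.
have [/existsP[b0 hb0]|/existsPn nb] :=
    boolP [exists b, abs (iota (child r m b) - c) < Q ^ (- m)].
  rewrite (prod_val_near hb0) mulrA [X in _ ^+ X.+1]card_pred !exprS !mulrA.
  rewrite ler_wpM2r ?exprn_ge0 ?Qz_ge0 //.
  rewrite [leRHS](_ : _ = Q ^ (- m) * (Q * val (child r m b0) (m + 1) c)); last by ring.
  rewrite ler_pM2l // [leLHS]Qz_succ ler_pM2l ?Q_gt0 //.
  by rewrite le_max lexx.
have hv b : Q ^ (- m) <= val (child r m b) (m + 1) c.
  by rewrite le_max [X in _ || X]leNgt nb orbT.
apply: (@le_trans _ _ (Q * Q ^ (- m) * (Q ^ (- m)) ^+ #|F|)).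
  rewrite exprS -mulrA ler_peMl ?mulr_ge0 ?exprn_ge0 ?Qz_ge0 //.
  exact: ltW Q_gt1.
rewrite ler_wpM2l ?mulr_ge0 ?Q_ge0 ?Qz_ge0 // -prodr_const.
by apply: ler_prod => b _; rewrite Qz_ge0 hv.
Qed.

Lemma val_harmonic N r m c : inside (N - 1) r m -> pole N c ->
  val r m c ^+ #|F|.+1 =
  val r (m - 1) c * \prod_(b : F) val (child r m b) (m + 1) c.
Proof.
move=> [mN mN' rN] pc.
have h0 := Qz_gt0 (- m).
have far : Q * Q ^ (- m) <= abs (iota r - c) -> val r m c ^+ #|F|.+1 =
    val r (m - 1) c * \prod_(b : F) val (child r m b) (m + 1) c.
  move=> A; have A' : Q ^ (- m) < abs (iota r - c).
    by apply: (lt_le_trans _ A); rewrite -Qz_pred Qz_lt; lia.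
  rewrite (eq_bigr (fun=> abs (iota r - c))) => [|b _]; last exact: val_child_far.
  rewrite prodr_const /val (max_idPr (ltW A')).
  by rewrite Qz_pred (max_idPr A) exprS.
case: pc => [cN|[s cs]].
  apply: far; rewrite abs_distC abs_domB.
    by apply: (le_trans _ (ltW cN)); rewrite -Qz_pred Qz_le; lia.
  by apply: (le_lt_trans rN); apply: (lt_trans _ cN); rewrite Qz_lt; lia.
have csm : abs (c - iota s) < Q ^ (- m).
  by apply: (lt_trans cs); rewrite Qz_lt; lia.
have csm' : abs (iota s - c) <= Q ^ (- (m + 1)).
  by rewrite abs_distC (le_trans (ltW cs)) // Qz_le; lia.
have [A|A] := ltP (Q ^ (- m)) (abs (iota r - c)).
  apply: far; rewrite -Qz_pred leNgt; apply/negP => A2.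
  have rs : abs (iota r - iota s) = abs (iota r - c).
    by rewrite -(subrKA c) abs_dom // (lt_trans csm).
  move: A2; rewrite -rs -rmorphB => /iota_disc.
  by rewrite rmorphB rs (_ : - (m - 1) - 1 = - m) ?leNgt ?A //; lia.
have rs : abs (iota ((s - r) / unif m)) <= 1.
  rewrite rmorphM fmorphV a_M absV abs_unif ler_pdivrMr // mul1r rmorphB.
  by rewrite -(subrKA c) ultraD // abs_distC // ltW.
have [b hb] := iota_residue rs.
have h1 : abs (iota (s - child r m b)) < Q ^ (- m).
  have -> : s - child r m b = unif m * ((s - r) / unif m - cst b).
    have u0 : unif m != 0 by rewrite -(fmorph_eq0 iota) -abs_gt0 abs_unif.
    by rewrite mulrBr [_ * (_ / _)]mulrC divfK // /child; ring.
  by rewrite rmorphM a_M abs_unif rmorphB -[ltRHS]mulr1 ltr_pM2l.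
have h2 : abs (iota (child r m b) - c) <= Q ^ (- (m + 1)).
  rewrite -(subrKA (iota s)) ultraD // -rmorphB -absN -rmorphN opprB.
  by have := iota_disc h1; rewrite (_ : - m - 1 = - (m + 1)) //; clear; lia.
have h3 : abs (iota (child r m b) - c) < Q ^ (- m).
  by apply: (le_lt_trans h2); rewrite Qz_lt; clear; lia.
rewrite (prod_val_near h3).
have -> : val (child r m b) (m + 1) c = Q ^ (- (m + 1)) by apply/max_idPl.
have -> : val r m c = Q ^ (- m) by apply/max_idPl.
have -> : val r (m - 1) c = Q * Q ^ (- m).
  by rewrite -Qz_pred; apply/max_idPl/(le_trans A); rewrite Qz_le; clear; lia.
rewrite [X in _ ^+ X.+1]card_pred !exprS.
by rewrite {1}(Qz_succ m); ring.
Qed.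

Local Notation Kinf := (Kinf iota abs).
Local Notation Omega := (Omega iota abs).
Local Notation Omega_affinoid := (Omega_affinoid iota abs).
Local Notation holomorphic := (holomorphic_Omega iota abs).

Lemma affinoid_pole (n : nat) c : ~ Omega_affinoid n c -> pole n c.
Proof.
move=> nc; apply: contrapT => /not_orP[/negP h1 h2]; apply: nc; split.
  by rewrite leNgt.
move=> x Kx; rewrite leNgt; apply/negP => cx; apply: h2.
have e0 : 0 < (Q ^- n : R) by rewrite invr_gt0 exprn_gt0 ?Q_gt0.
have [s xs] := Kx _ e0; exists s; rewrite -exprnN.
by rewrite -(subrKA x) ultraD_lt.
Qed.

Lemma fib_Kinf r m z x : fib r m z -> Kinf x -> Q ^ (- m) <= abs (z - x).
Proof.
move=> fz Kx; have [s xs] := Kx _ (Qz_gt0 (- m)).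
rewrite leNgt; apply/negP => zx; have := fz.2 s.
by rewrite leNgt -(subrKA x) ultraD_lt.
Qed.

Lemma fib_Omega r m z : fib r m z -> Omega z.
Proof.
by move=> fz Kz; have := fib_Kinf fz Kz; rewrite subrr abs0 leNgt Qz_gt0.
Qed.

Lemma fib_affinoid (n : nat) r m z : inside n r m -> fib r m z -> Omega_affinoid n z.
Proof.
move=> i fz; split; first exact: fib_inside i fz.
move=> x Kx; apply: le_trans (fib_Kinf fz Kx).
by case: i => mn _ _; rewrite exprnN Qz_le; lia.
Qed.

Definition rts (P : {poly C}) : seq C := sval (closed_field_poly_normal P).

Lemma horner_rts P z : P.[z] = lead_coef P * \prod_(c <- rts P) (z - c).
Proof.
rewrite [in LHS](svalP (closed_field_poly_normal P)) -/(rts P).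
rewrite hornerZ horner_prod; congr (_ * _).
by apply: eq_bigr => c _; rewrite hornerXsubC.
Qed.

Lemma root_rts P c : c \in rts P -> root P c.
Proof.
move=> cP; apply/rootP; rewrite horner_rts (big_rem c) //=.
by rewrite subrr mul0r mulr0.
Qed.

(* The Gauss norm of P on the disc (r, m). *)
Definition gval P r m : R := abs (lead_coef P) * \prod_(c <- rts P) val r m c.

Lemma prod_val_gt0 s r m : 0 < \prod_(c <- s) val r m c.
Proof. by apply: prodr_gt0 => c _; apply: val_gt0. Qed.

Lemma gval_ge0 P r m : 0 <= gval P r m.
Proof. by rewrite mulr_ge0 ?a_ge0 // ltW ?prod_val_gt0. Qed.

Lemma gval_gt0 P r m : P != 0 -> 0 < gval P r m.
Proof. by move=> P0; rewrite mulr_gt0 ?prod_val_gt0 // abs_gt0 lead_coef_eq0. Qed.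

Lemma le_gval P r m z : fib r m z -> abs P.[z] <= gval P r m.
Proof.
move=> [fz _]; rewrite horner_rts a_M abs_prod ler_wpM2l ?a_ge0 //.
by apply: ler_prod => c _; rewrite a_ge0 le_val.
Qed.

Lemma eq_gval P r m z : fib r m z ->
  (forall c, c \in rts P -> Q ^ (- m) <= abs (z - c)) -> abs P.[z] = gval P r m.
Proof.
move=> [fz _] h; rewrite horner_rts a_M abs_prod; congr (_ * _).
by rewrite big_seq [RHS]big_seq; apply: eq_bigr => c /h hc; apply: eq_val.
Qed.

Lemma gval_subharmonic P r m :
  gval P r m ^+ #|F|.+1 <=
  gval P r (m - 1) * \prod_(b : F) gval P (child r m b) (m + 1).
Proof.
rewrite /gval big_split prodr_const exchange_big /= exprMn.
rewrite mulrACA -exprS ler_wpM2l ?exprn_ge0 ?a_ge0 //.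
rewrite -prodrXl -big_split /=; apply: ler_prod => c _.
by rewrite exprn_ge0 ?(ltW (val_gt0 _ _ _)) // val_subharmonic.
Qed.

Lemma gval_harmonic N P r m : inside (N - 1) r m ->
  (forall c, c \in rts P -> pole N c) ->
  gval P r m ^+ #|F|.+1 =
  gval P r (m - 1) * \prod_(b : F) gval P (child r m b) (m + 1).
Proof.
move=> i h; rewrite /gval big_split prodr_const exchange_big /= exprMn.
rewrite mulrACA -exprS; congr (_ * _).
rewrite -prodrXl -big_split /= big_seq [RHS]big_seq.
by apply: eq_bigr => c /h hc; apply: (val_harmonic i).
Qed.

Lemma inside_exists r m : exists n : nat, inside (n%:Z - 1) r m.
Proof.
have [k rk] : exists k : int, abs (iota r) <= Q ^ k.
  have [->|/iota_val[k ->]] := eqVneq r 0; last by exists k.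
  by exists 0; rewrite rmorph0 abs0 expr0z ler01.
exists (`|k| + `|m| + 1)%N; split; [lia|lia|].
by apply: (le_trans rk); rewrite Qz_le; lia.
Qed.

Lemma inside_parent N r m : inside (N - 1) r m -> inside N r (m - 1).
Proof.
move=> [h1 h2 h3]; split; [lia|lia|].
by apply: (le_trans h3); rewrite Qz_le; lia.
Qed.

Lemma inside_child N r m b : inside (N - 1) r m -> inside N (child r m b) (m + 1).
Proof.
move=> [h1 h2 h3]; split; [lia|lia|].
rewrite -(subrK (iota r) (iota (child r m b))) ultraD //.
  by apply: (le_trans (abs_child_sub _ _ _)); rewrite Qz_le; lia.
by apply: (le_trans h3); rewrite Qz_le; lia.
Qed.

Lemma inside_le N r m : inside (N - 1) r m -> inside N r m.
Proof.
move=> [h1 h2 h3]; split; [lia|lia|].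
by apply: (le_trans h3); rewrite Qz_le; lia.
Qed.

Lemma holomorphic_approx f (n : nat) eps : holomorphic f -> 0 < eps ->
  (exists r m, inside n r m) ->
  exists P S : {poly C}, [/\ S != 0, forall c, c \in rts S -> pole n c
    & forall r m z, inside n r m -> fib r m z -> abs (f z - P.[z] / S.[z]) < eps].
Proof.
move=> hf e0 [r0 [m0 i0]]; have [P [S h]] := hf n eps e0.
exists P, S; split=> [|c /root_rts cS|r m z i fz].
- have [z fz] := fib_nonempty r0 m0.
  have [+ _] := h z (fib_affinoid i0 fz).
  by apply: contraNneq => ->; rewrite root0.
- by apply: affinoid_pole => ac; have [] := h c ac; rewrite cS.
- by have [] := h z (fib_affinoid i fz).
Qed.

Definition grat P S r m : R := gval P r m / gval S r m.

Lemma eq_gval_pole N S r m z : inside N r m -> (forall c, c \in rts S -> pole N c) ->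
  fib r m z -> abs S.[z] = gval S r m.
Proof.
move=> i h fz; apply: eq_gval => // c /h hc; exact: pole_fib i hc fz.
Qed.

Lemma le_grat N P S r m z : inside N r m -> (forall c, c \in rts S -> pole N c) ->
  fib r m z -> abs (P.[z] / S.[z]) <= grat P S r m.
Proof.
move=> i h fz; rewrite abs_div (eq_gval_pole i h fz).
by rewrite ler_wpM2r ?invr_ge0 ?gval_ge0 ?le_gval.
Qed.

Lemma grat_attained N P S r m : inside N r m -> (forall c, c \in rts S -> pole N c) ->
  exists2 z, fib r m z & abs (P.[z] / S.[z]) = grat P S r m.
Proof.
move=> i h; have [z fz hz] := fib_avoid r m (rts P).
exists z => //; rewrite abs_div (eq_gval_pole i h fz).
by rewrite (eq_gval fz).
Qed.

Lemma grat_ge0 P S r m : 0 <= grat P S r m.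
Proof. by rewrite divr_ge0 ?gval_ge0. Qed.

Lemma grat_subharmonic N P S r m : inside (N - 1) r m ->
  (forall c, c \in rts S -> pole N c) -> S != 0 ->
  grat P S r m ^+ #|F|.+1 <=
  grat P S r (m - 1) * \prod_(b : F) grat P S (child r m b) (m + 1).
Proof.
move=> i h S0; rewrite /grat expr_div_n prodf_div mulf_div (gval_harmonic i h).
by rewrite ler_wpM2r ?gval_subharmonic // invr_ge0 mulr_ge0 ?gval_ge0 ?prodr_ge0 //
  => b _; apply: gval_ge0.
Qed.

(* [nrm f e r m] is the supremum over [fib r m] of max(|f|, e); the truncation at e > 0
   makes its logarithm finite and insensitive to an approximation within e. *)
Definition is_nrm (f : C -> C) e r m v : Prop :=
  (exists2 z, fib r m z & v = Num.max (abs (f z)) e) /\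
  (forall z, fib r m z -> Num.max (abs (f z)) e <= v).

Definition nrm f e r m : R := xget 0 [set v | is_nrm f e r m v]%classic.

Lemma is_nrm_uniq f e r m v v' : is_nrm f e r m v -> is_nrm f e r m v' -> v = v'.
Proof.
move=> [[z fz ->] h] [[z' fz' ->] h'].
by apply/le_anti; rewrite h' // h.
Qed.

Lemma nrmE f e r m v : is_nrm f e r m v -> nrm f e r m = v.
Proof.
move=> h; rewrite /nrm; case: xgetP => [w _ hw|/(_ v)//].
exact: is_nrm_uniq hw h.
Qed.

Lemma max_close x y e : abs (x - y) < e -> Num.max (abs x) e = Num.max (abs y) e.
Proof.
move=> xy; have [ex|ex] := leP e (abs x).
  suff -> : abs y = abs x by rewrite (max_idPl ex).
  by rewrite -(subKr x y) abs_domB // (lt_le_trans xy).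
apply/esym/max_idPr.
by rewrite -(subKr x y) ltW // ultraB_lt.
Qed.

Lemma is_nrm_grat f (n : nat) e P S r m : inside n r m ->
  (forall c, c \in rts S -> pole n c) ->
  (forall z, fib r m z -> abs (f z - P.[z] / S.[z]) < e) ->
  is_nrm f e r m (Num.max (grat P S r m) e).
Proof.
move=> i h hf; split.
  have [z fz <-] := grat_attained P i h.
  by exists z => //; apply/esym/max_close/hf.
move=> z fz; rewrite (max_close (hf z fz)).
by rewrite ge_max !le_max (le_grat P i h fz) lexx orbT.
Qed.

Section Nrm.
Variables (f : C -> C) (e : R).
Hypotheses (hf : holomorphic f) (e0 : 0 < e).

Lemma nrmP r m : is_nrm f e r m (nrm f e r m).
Proof.
have [n i] := inside_exists r m; have {}i := inside_le i.
have [|P [S [S0 h1 h2]]] := @holomorphic_approx f n e hf e0; first by exists r, m.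
have h := is_nrm_grat i h1 (fun z => h2 r m z i).
by rewrite (nrmE h).
Qed.

Lemma nrm_le r m z : fib r m z -> abs (f z) <= nrm f e r m.
Proof. by move=> fz; apply: le_trans ((nrmP r m).2 z fz); rewrite le_max lexx. Qed.

Lemma nrm_ge r m : e <= nrm f e r m.
Proof. by have [[z _ ->] _] := nrmP r m; rewrite le_max lexx orbT. Qed.

Lemma nrm_gt0 r m : 0 < nrm f e r m.
Proof. exact: lt_le_trans e0 (nrm_ge r m). Qed.

Lemma nrm_attained r m : exists2 z, fib r m z & nrm f e r m = Num.max (abs (f z)) e.
Proof. by have [] := nrmP r m. Qed.

Lemma nrm_le_bound r m B : e <= B -> (forall z, fib r m z -> abs (f z) <= B) ->
  nrm f e r m <= B.
Proof. by move=> eB h; have [z fz ->] := nrm_attained r m; rewrite ge_max eB h. Qed.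

Lemma nrm_subharmonic r m :
  nrm f e r m ^+ #|F|.+1 <=
  nrm f e r (m - 1) * \prod_(b : F) nrm f e (child r m b) (m + 1).
Proof.
have [n i] := inside_exists r m.
have [|P [S [S0 h1 h2]]] := @holomorphic_approx f n e hf e0.
  by exists r, m; apply: inside_le.
have E r' m' : inside n r' m' -> nrm f e r' m' = Num.max (grat P S r' m') e.
  by move=> i'; apply/nrmE/(is_nrm_grat i' h1) => z; apply: h2.
rewrite (E r m (inside_le i)).
have [G|G] := leP (grat P S r m) e.
  rewrite exprS ler_pM ?exprn_ge0 ?(ltW e0) ?nrm_ge //.
  by rewrite -prodr_const ler_prod // => b _; rewrite nrm_ge ltW.
apply: (le_trans (grat_subharmonic P i h1 S0)).
have p0 : 0 <= \prod_(b : F) grat P S (child r m b) (m + 1).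
  by apply: prodr_ge0 => b _; exact: grat_ge0.
rewrite ler_pM ?grat_ge0 //.
- by rewrite E ?le_max ?lexx //; apply: inside_parent.
- by apply: ler_prod => b _; rewrite E ?le_max ?lexx ?grat_ge0 //; apply: inside_child.
Qed.

End Nrm.

Lemma ln_prod (I : Type) (s : seq I) (g : I -> R) : (forall i, 0 < g i) ->
  ln (\prod_(i <- s) g i) = \sum_(i <- s) ln (g i).
Proof.
move=> g0; elim: s => [|i s IHs]; first by rewrite !big_nil ln1.
by rewrite !big_cons lnM ?IHs // posrE ?g0 // prodr_gt0.
Qed.

Lemma lnQ_gt0 : 0 < ln Q. Proof. by rewrite ln_gt0 ?Q_gt1. Qed.

Lemma ln_maxr_le (x x0 x1 a t : R) : 0 < x0 -> x0 <= x -> x <= x1 ->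
  0 <= t <= 1 -> ln x = (1 - t) * ln x0 + t * ln x1 ->
  ln (Num.max x a) <= (1 - t) * ln (Num.max x0 a) + t * ln (Num.max x1 a).
Proof.
move=> x00 x0x xx1 /andP[t0 t1] E.
have x10 : 0 < x1 by apply: lt_le_trans xx1; apply: lt_le_trans x0x.
have lnm y : 0 < y -> ln y <= ln (Num.max y a).
  by move=> y0; rewrite ler_ln ?posrE ?lt_max ?y0 ?le_max ?lexx.
have h : ln x <= (1 - t) * ln (Num.max x0 a) + t * ln (Num.max x1 a).
  by rewrite E lerD // ler_wpM2l ?subr_ge0 ?lnm.
have [ax|xa] := leP a x; first by [].
have a0 : 0 < a by apply: lt_trans xa; apply: lt_le_trans x0x.
have h1 : ln a <= ln (Num.max x1 a).
  by rewrite ler_ln ?posrE ?le_max ?lexx ?orbT // lt_max a0 orbT.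
rewrite [Num.max x0 a](max_idPr (le_trans x0x (ltW xa))).
rewrite -[leLHS]mul1r -{1}(subrK t 1) mulrDl lerD2l ler_wpM2l //.
Qed.

Lemma ln_maxr_eq (x x0 x1 a t : R) : 0 < x0 -> x0 <= x -> x <= x1 ->
  ln x = (1 - t) * ln x0 + t * ln x1 -> (a <= x0) || (x1 <= a) ->
  ln (Num.max x a) = (1 - t) * ln (Num.max x0 a) + t * ln (Num.max x1 a).
Proof.
move=> x00 x0x xx1 E /orP[a0|a1].
  by rewrite !(max_idPl _) // ?(le_trans a0) ?(le_trans x0x).
rewrite !(max_idPr _) // ?(le_trans xx1) ?(le_trans x0x) ?(le_trans xx1) //.
by ring.
Qed.

Lemma Qn_unbounded (B : R) : exists n : nat, B < Q ^+ n.
Proof.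
exists (Num.bound `|B|); apply: (le_lt_trans (ler_norm B)).
apply: (lt_le_trans (archi_boundP (normr_ge0 B))).
by rewrite -natrX ler_nat ltnW // ltn_expl // card_gt1.
Qed.

(** * The identity theorem on Omega *)

Lemma Omega_annulus z : Omega z -> exists r m,
  [/\ Q ^ (- (m + 1)) <= abs (z - iota r), abs (z - iota r) <= Q ^ (- m)
    & forall s, abs (z - iota r) <= abs (z - iota s)].
Proof.
move=> Oz.
have [eps e0 he] : exists2 eps, 0 < eps & forall y, eps <= abs (z - iota y).
  apply: contrapT => nh; apply: Oz => eps e0.
  apply: contrapT => ny; apply: nh; exists eps => // y.
  by rewrite leNgt; apply/negP => zy; apply: ny; exists y.
have [k1 hk1] := Qn_unbounded (abs z).
have [k2 hk2] := Qn_unbounded eps^-1.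
pose D (n : nat) := `[< exists r, abs (z - iota r) < Q ^ (k1%:Z - n%:Z) >].
have D0 : exists n, D n.
  by exists 0%N; apply/asboolP; exists 0; rewrite rmorph0 !subr0.
have Db n : D n -> (n <= k1 + k2)%N.
  move=> /asboolP[r hr]; have := le_lt_trans (he r) hr.
  have h2 : Q ^ (- k2%:Z) < eps.
    by rewrite -exprnN invf_plt // posrE exprn_gt0 ?Q_gt0.
  by move=> /(lt_trans h2); rewrite Qz_lt; lia.
case: (ex_maxnP D0 Db) => n /asboolP[r hr] hmax.
have hs s : Q ^ (k1%:Z - n%:Z - 1) <= abs (z - iota s).
  rewrite leNgt; apply/negP => hs; suff /hmax : D n.+1 by rewrite ltnn.
  by apply/asboolP; exists s; apply: (lt_le_trans hs); rewrite Qz_le; lia.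
exists r, (n%:Z - k1%:Z); split.
- by apply: (le_trans _ (hs r)); rewrite Qz_le; lia.
- by rewrite opprB ltW.
- move=> s; rewrite leNgt; apply/negP => sr.
  have E : abs (iota (r - s)) = abs (z - iota r).
    have -> : iota (r - s) = (z - iota s) - (z - iota r) by rewrite rmorphB; ring.
    rewrite [LHS]abs_distC. exact: abs_domB.
  have := iota_disc (m := k1%:Z - n%:Z) (x := r - s); rewrite E => /(_ hr).
  by rewrite leNgt (le_lt_trans (hs s)).
Qed.

Section Annulus.
Variables (z : C) (r : K) (m : int).
Let rho := abs (z - iota r).
Hypotheses (rho_lo : Q ^ (- (m + 1)) <= rho) (rho_hi : rho <= Q ^ (- m)).
Hypothesis nearest : forall s, rho <= abs (z - iota s).

Let rho0 : 0 < rho. Proof. exact: lt_le_trans (Qz_gt0 _) rho_lo. Qed.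

Let t := (ln rho - ln (Q ^ (- (m + 1)))) / ln Q.

Let ln_step : ln (Q ^ (- m)) - ln (Q ^ (- (m + 1))) = ln Q.
Proof. by rewrite Qz_succ lnM ?posrE ?Q_gt0 ?Qz_gt0 // addrK. Qed.

Let t01 : 0 <= t <= 1.
Proof.
rewrite /t ler_pdivrMr ?lnQ_gt0 // mul1r divr_ge0 ?(ltW lnQ_gt0) //=.
  by rewrite -ln_step lerD2r ler_ln ?posrE ?Qz_gt0.
by rewrite subr_ge0 ler_ln ?posrE ?Qz_gt0.
Qed.

Let lnrho : ln rho = (1 - t) * ln (Q ^ (- (m + 1))) + t * ln (Q ^ (- m)).
Proof.
have -> : (1 - t) * ln (Q ^ (- (m + 1))) + t * ln (Q ^ (- m)) =
  ln (Q ^ (- (m + 1))) + t * (ln (Q ^ (- m)) - ln (Q ^ (- (m + 1)))) by ring.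
by rewrite ln_step /t divfK ?gt_eqF ?lnQ_gt0 // addrC subrK.
Qed.

Let vz c : R := Num.max rho (abs (iota r - c)).
Let vz0 c : 0 < vz c. Proof. by rewrite lt_max rho0. Qed.

Lemma annulus_le_val c : abs (z - c) <= vz c.
Proof.
rewrite -(subrK (iota r) z) -addrA ultraD // le_max ?lexx ?orbT //.
Qed.

Lemma annulus_pole N c : inside N r (m + 1) -> inside N r m -> Q ^ (- N) < rho ->
  pole N c -> abs (z - c) = vz c /\
  (abs (iota r - c) <= Q ^ (- (m + 1))) || (Q ^ (- m) <= abs (iota r - c)).
Proof.
move=> [h1 h2 h3] [h1' h2' _] rN pc.
have zN : abs z <= Q ^ N.
  rewrite -(subrK (iota r) z) ultraD //.
  by apply: (le_trans rho_hi); rewrite Qz_le.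
have [zc dis] : rho <= abs (z - c) /\
    (abs (iota r - c) <= Q ^ (- (m + 1))) || (Q ^ (- m) <= abs (iota r - c)).
  case: pc => [cN|[s cs]].
    rewrite abs_distC abs_domB ?(le_lt_trans zN) //; split.
      by apply: (le_trans rho_hi); apply: (le_trans _ (ltW cN)); rewrite Qz_le.
    rewrite abs_distC abs_domB ?(le_lt_trans h3) //; apply/orP; right.
    by apply: (le_trans _ (ltW cN)); rewrite Qz_le.
  split.
    rewrite -(subrKA (iota s) z (- c)) abs_dom // [X in X < _]abs_distC.
    by apply: (lt_le_trans cs); apply: (le_trans (ltW rN)).
  have cs' : abs (iota s - c) < Q ^ (- (m + 1)).
    by rewrite abs_distC; apply: (lt_le_trans cs); rewrite Qz_le; lia.
  have [rs|rs] := ltP (abs (iota (r - s))) (Q ^ (- m)).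
    apply/orP; left; rewrite -(subrKA (iota s) (iota r) (- c)) -rmorphB ultraD ?(ltW cs') //.
    by have := iota_disc rs; rewrite (_ : - m - 1 = - (m + 1)) //; clear; lia.
  apply/orP; right; rewrite -(subrKA (iota s) (iota r) (- c)) -rmorphB abs_dom //.
  by apply: (lt_le_trans cs'); apply: le_trans rs; rewrite Qz_le; clear; lia.
split=> //; apply/le_anti; rewrite annulus_le_val /= ge_max zc /=.
by rewrite -(subrKA z (iota r) (- c)) ultraD // [X in X <= _]abs_distC.
Qed.

Lemma annulus_rat N P S : inside N r (m + 1) -> inside N r m -> Q ^ (- N) < rho ->
  (forall c, c \in rts S -> pole N c) -> S != 0 ->
  abs (P.[z] / S.[z]) <= Num.max (grat P S r m) (grat P S r (m + 1)).
Proof.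
move=> i1 i2 rN hS S0.
have Qm : Q ^ (- (m + 1)) <= Q ^ (- m) by rewrite Qz_le; lia.
have [->|P0] := eqVneq P 0.
  by rewrite horner0 mul0r abs0 le_max grat_ge0.
have ES : abs S.[z] = abs (lead_coef S) * \prod_(c <- rts S) vz c.
  rewrite horner_rts a_M abs_prod big_seq [in RHS]big_seq; congr (_ * _).
  by apply: eq_bigr => c /hS /(annulus_pole i1 i2 rN)[].
have EP : abs P.[z] <= abs (lead_coef P) * \prod_(c <- rts P) vz c.
  rewrite horner_rts a_M abs_prod ler_wpM2l ?a_ge0 //.
  by apply: ler_prod => c _; rewrite a_ge0 annulus_le_val.
have lP : 0 < abs (lead_coef P) by rewrite abs_gt0 lead_coef_eq0.
have lS : 0 < abs (lead_coef S) by rewrite abs_gt0 lead_coef_eq0.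
have pv (s : seq C) : 0 < \prod_(c <- s) vz c by apply: prodr_gt0.
have gpos m' : 0 < grat P S r m' by rewrite divr_gt0 ?gval_gt0.
rewrite abs_div ES; apply: (@le_trans _ _ (abs (lead_coef P) * \prod_(c <- rts P) vz c /
   (abs (lead_coef S) * \prod_(c <- rts S) vz c))).
  by rewrite ler_wpM2r // invr_ge0 mulr_ge0 ?(ltW lS) ?(ltW (pv _)).
have lng m' : ln (grat P S r m') = ln (abs (lead_coef P)) - ln (abs (lead_coef S)) +
   (\sum_(c <- rts P) ln (val r m' c) - \sum_(c <- rts S) ln (val r m' c)).
  rewrite /grat /gval ln_div ?posrE ?mulr_gt0 ?prod_val_gt0 //.
  rewrite !lnM ?posrE ?prod_val_gt0 // !ln_prod; try by move=> ?; apply: val_gt0.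
  by ring.
rewrite -ler_ln ?posrE ?divr_gt0 ?mulr_gt0 ?pv ?lt_max ?gpos //.
apply: (@le_trans _ _ ((1 - t) * ln (grat P S r (m + 1)) + t * ln (grat P S r m))).
  rewrite !lng ln_div ?posrE ?mulr_gt0 ?pv // !lnM ?posrE ?pv // !ln_prod //.
  have hP : \sum_(c <- rts P) ln (vz c) <= (1 - t) * \sum_(c <- rts P) ln (val r (m + 1) c)
      + t * \sum_(c <- rts P) ln (val r m c).
    rewrite !mulr_sumr -big_split /=; apply: ler_sum => c _.
    by apply: ln_maxr_le; rewrite ?Qz_gt0.
  have hS' : \sum_(c <- rts S) ln (vz c) = (1 - t) * \sum_(c <- rts S) ln (val r (m + 1) c)
      + t * \sum_(c <- rts S) ln (val r m c).
    rewrite !mulr_sumr -big_split /= big_seq [RHS]big_seq; apply: eq_bigr => c /hS pc.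
    by apply: ln_maxr_eq; rewrite ?Qz_gt0 //; case: (annulus_pole i1 i2 rN pc).
  rewrite hS' -subr_ge0; rewrite -subr_ge0 in hP.
  by apply: (le_trans hP); rewrite le_eqVlt; apply/orP; left; apply/eqP; ring.
have /andP[t0 t1] := t01.
have mx m' : grat P S r m' <= Num.max (grat P S r m) (grat P S r (m + 1)) ->
   ln (grat P S r m') <= ln (Num.max (grat P S r m) (grat P S r (m + 1))).
  by move=> h; rewrite ler_ln ?posrE ?lt_max ?gpos.
have h1 : ln (grat P S r m) <= ln (Num.max (grat P S r m) (grat P S r (m + 1))).
  by apply: mx; rewrite le_max lexx.
have h2 : ln (grat P S r (m + 1)) <= ln (Num.max (grat P S r m) (grat P S r (m + 1))).
  by apply: mx; rewrite le_max lexx orbT.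
move: h1 h2; set A := ln (Num.max _ _) => h1 h2.
have -> : A = (1 - t) * A + t * A by ring.
by rewrite lerD // ler_wpM2l // subr_ge0.
Qed.

End Annulus.

Lemma holomorphic_identity f : holomorphic f ->
  (forall r m z, fib r m z -> f z = 0) -> forall z, Omega z -> f z = 0.
Proof.
move=> hf h z Oz; have [r [m [h1 h2 h3]]] := Omega_annulus Oz.
have rho0 : 0 < abs (z - iota r) by apply: lt_le_trans h1; apply: Qz_gt0.
apply/eqP; rewrite -abs_eq0b eq_le a_ge0 andbT leNgt; apply/negP => fz.
have [n0 i0] := inside_exists r m.
have [k hk] := Qn_unbounded (abs (z - iota r))^-1.
pose n := (n0 + k)%N.
have i0' : inside (n%:Z - 1) r m.
  by case: i0 => a b c; split; [lia|lia|]; apply: (le_trans c); rewrite Qz_le; lia.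
have i1 : inside n r (m + 1).
  by case: i0' => a b c; split; [lia|lia|]; apply: (le_trans c); rewrite Qz_le; lia.
have i2 := inside_le i0'.
have rN : Q ^ (- n%:Z) < abs (z - iota r).
  apply: (@le_lt_trans _ _ (Q ^ (- k%:Z))); first by rewrite Qz_le; lia.
  by rewrite -exprnN invf_plt // posrE exprn_gt0 ?Q_gt0.
have [P [S hPS]] := hf n _ fz.
have [z0 fz0] := fib_nonempty r m.
have S0 : S != 0.
  have [+ _] := hPS z0 (fib_affinoid i2 fz0).
  by apply: contraNneq => ->; rewrite root0.
have hS c : c \in rts S -> pole n c.
  move=> /root_rts cS; apply: affinoid_pole => ac.
  by have [] := hPS c ac; rewrite cS.
have gs m' : inside n r m' -> grat P S r m' < abs (f z).
  move=> i; have [y fy <-] := grat_attained P i hS.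
  have [_] := hPS y (fib_affinoid i fy).
  by rewrite (h _ _ _ fy) add0r absN.
have az : Omega_affinoid n z.
  split.
    rewrite -(subrK (iota r) z) ultraD //; last by case: i2.
    by apply: (le_trans h2); rewrite exprnP Qz_le; case: i2.
  move=> x Kx; have [s xs] := Kx _ rho0.
  rewrite exprnN (le_trans (ltW rN)) // leNgt; apply/negP => zx.
  by have := h3 s; rewrite leNgt -(subrKA x) ultraD_lt.
have [_ fPS] := hPS z az.
have : abs (f z) < abs (f z).
  rewrite -{1}(subrK (P.[z] / S.[z]) (f z)) ultraD_lt //.
  apply: (le_lt_trans (annulus_rat h1 h2 h3 P i1 i2 rN hS S0)).
  by rewrite gt_max !gs.
by rewrite ltxx.
Qed.

(** * Subharmonic functions on the tree *)

Definition lg (x : R) : R := ln x / ln Q.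

Lemma lgM x y : 0 < x -> 0 < y -> lg (x * y) = lg x + lg y.
Proof. by move=> x0 y0; rewrite /lg lnM ?posrE // mulrDl. Qed.

Lemma lgQz (k : int) : lg (Q ^ k) = k%:~R.
Proof.
have h (n : nat) : lg (Q ^+ n) = n%:R.
  by rewrite /lg lnXn ?Q_gt0 // -[ln Q *+ n]mulr_natl mulfK // gt_eqF // lnQ_gt0.
case: k => n; first exact: h.
rewrite NegzE -exprnN.
have -> : lg (Q ^+ n.+1)^-1 = - lg (Q ^+ n.+1).
  by rewrite /lg lnV ?mulNr // posrE exprn_gt0 ?Q_gt0.
by rewrite h rmorphN.
Qed.

Lemma lgXn x (n : nat) : 0 < x -> lg (x ^+ n) = n%:R * lg x.
Proof. by move=> x0; rewrite /lg lnXn // -[ln x *+ n]mulr_natl mulrA. Qed.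

Lemma ler_lg x y : 0 < x -> 0 < y -> (lg x <= lg y) = (x <= y).
Proof.
move=> x0 y0; rewrite /lg ler_pM2r ?invr_gt0 ?lnQ_gt0 //.
by rewrite ler_ln ?posrE.
Qed.

Lemma lg_prod (I : Type) (s : seq I) (g : I -> R) : (forall i, 0 < g i) ->
  lg (\prod_(i <- s) g i) = \sum_(i <- s) lg (g i).
Proof. by move=> g0; rewrite /lg ln_prod // mulr_suml. Qed.

Definition phi f e r m : R := lg (nrm f e r m).

Lemma fib_same r r' m z : abs (iota r - iota r') <= Q ^ (- m) -> fib r m z -> fib r' m z.
Proof. by move=> h [h1 h2]; split=> //; rewrite -(subrKA (iota r)) ultraD. Qed.

Section Phi.
Variables (f : C -> C) (e : R).
Hypotheses (hf : holomorphic f) (e0 : 0 < e).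

Lemma phi_subharmonic r m : (#|F|%:R + 1) * phi f e r m <=
  phi f e r (m - 1) + \sum_(b : F) phi f e (child r m b) (m + 1).
Proof.
have n0 r' m' := nrm_gt0 hf e0 r' m'.
rewrite /phi -lg_prod // -lgM ?prodr_gt0 // natr1 -lgXn //.
by rewrite ler_lg ?exprn_gt0 ?mulr_gt0 ?prodr_gt0 // nrm_subharmonic.
Qed.

Lemma phi_le r m B : 0 < B -> e <= B -> (forall z, fib r m z -> abs (f z) <= B) ->
  phi f e r m <= lg B.
Proof. by move=> B0 eB h; rewrite ler_lg ?nrm_gt0 // nrm_le_bound. Qed.

Lemma phi_ge r m z : fib r m z -> 0 < abs (f z) -> lg (abs (f z)) <= phi f e r m.
Proof. by move=> fz f0; rewrite ler_lg ?nrm_gt0 // nrm_le. Qed.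

Lemma nrm_same r r' m : abs (iota r - iota r') <= Q ^ (- m) ->
  nrm f e r m = nrm f e r' m.
Proof.
move=> h; have h' : abs (iota r' - iota r) <= Q ^ (- m) by rewrite abs_distC.
have [[z fz E] hz] := nrmP hf e0 r m.
apply/esym/nrmE; split; first by exists z => //; apply: fib_same fz.
by move=> y fy; apply: hz; apply: fib_same fy.
Qed.

Lemma phi_same r r' m : abs (iota r - iota r') <= Q ^ (- m) ->
  phi f e r m = phi f e r' m.
Proof. by move=> h; rewrite /phi (nrm_same h). Qed.

Lemma phi_child r m b : phi f e (child r m b) m = phi f e r m.
Proof. exact: phi_same (abs_child_sub _ _ _). Qed.

Hypothesis pf : A_periodic iota abs f.

Lemma fib_translate r m a z : fib r m z -> fib (r + FracField.tofrac a) m (z + inA a).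
Proof.
move=> [h1 h2]; split.
  by rewrite rmorphD opprD addrACA subrr addr0.
move=> s; have := h2 (s - FracField.tofrac a).
by rewrite rmorphB opprB addrA addrAC.
Qed.

Lemma phi_translate r m a : phi f e (r + FracField.tofrac a) m = phi f e r m.
Proof.
rewrite /phi; congr lg; apply: nrmE.
have [[z fz E] hz] := nrmP hf e0 r m; split.
  exists (z + inA a); first exact: fib_translate.
  by rewrite pf //; apply: fib_Omega fz.
move=> y /(@fib_translate _ _ (- a)); rewrite rmorphN addrK inA_N => fy.
by rewrite -(subrK (inA a) y) pf ?hz //; apply: fib_Omega fy.
Qed.

(* At the vertex (0, -n) all q children are translates of one another by A. *)
Lemma phi_periodic_subharmonic (n : nat) :
  (#|F|%:R + 1) * phi f e 0 (- n%:Z) <=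
  phi f e 0 (- n.+1%:Z) + #|F|%:R * phi f e 0 (- n%:Z + 1).
Proof.
apply: (le_trans (phi_subharmonic 0 (- n%:Z))).
rewrite (_ : - n%:Z - 1 = - n.+1%:Z); last by lia.
rewrite lerD2l (eq_bigr (fun=> phi f e 0 (- n%:Z + 1))) => [|b _].
  by rewrite sumr_const mulr_natl lexx.
have -> : child 0 (- n%:Z) b = 0 + FracField.tofrac (b%:P * 'X^n).
  by rewrite /child /unif /cst opprK tofracM tofracXn.
exact: phi_translate.
Qed.

End Phi.

Lemma convex_growth (u : nat -> R) (d : R) : 0 <= d ->
  (forall n, (d + 1) * u n.+1 <= u n.+2 + d * u n) ->
  forall n, u 0 + (u 1 - u 0) * (\sum_(i < n) d ^+ i) <= u n.
Proof.
move=> d0 h n.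
have step k : (u 1 - u 0) * d ^+ k <= u k.+1 - u k.
  elim: k => [|k IHk]; first by rewrite expr0 mulr1.
  have := h k; have := ler_wpM2l d0 IHk.
  by rewrite exprS mulrCA; set A := (u 1 - u 0) * _; lra.
elim: n => [|n IHn]; first by rewrite big_ord0 mulr0 addr0.
rewrite big_ord_recr /= mulrDr addrA.
by have := step n; move: IHn; set A := u 0 + _; lra.
Qed.

Lemma convex_bounded (u : nat -> R) (d : R) (B : R) (n0 : nat) : 1 <= d ->
  (forall n, (d + 1) * u n.+1 <= u n.+2 + d * u n) ->
  (forall n, (n0 <= n)%N -> u n <= B) -> forall n, u n <= u 0.
Proof.
move=> d1 h hB.
have d0 : 0 <= d by apply: le_trans d1.
have decr k : u k.+1 <= u k.
  rewrite leNgt; apply/negP => uk; pose v n := u (n + k)%N.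
  have hv n : (d + 1) * v n.+1 <= v n.+2 + d * v n by exact: h.
  have g := convex_growth d0 hv.
  have dk : 0 < v 1 - v 0 by rewrite subr_gt0.
  pose n := (n0 + Num.bound (`|B - v 0| / (v 1 - v 0))%R)%N.
  have vn : v n <= B by apply: hB; rewrite /n; lia.
  have sn : n%:R <= \sum_(i < n) d ^+ i.
    rewrite -[n%:R](_ : \sum_(i < n) 1 = _); last by rewrite sumr_const card_ord.
    by apply: ler_sum => i _; apply: exprn_ege1.
  have nb : `|B - v 0| / (v 1 - v 0) < n%:R.
    apply: (lt_le_trans (archi_boundP _)); first by rewrite divr_ge0 // ltW.
    by rewrite ler_nat leq_addl.
  have : B - v 0 < (v 1 - v 0) * \sum_(i < n) d ^+ i.
    apply: (le_lt_trans (ler_norm _)); rewrite mulrC -ltr_pdivrMr //.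
    exact: lt_le_trans nb sn.
  by have := g n; move: vn; set S := (_ * _); lra.
by elim=> // n IHn; apply: le_trans IHn.
Qed.

(** * The Carlitz exponential and expansions at infinity *)

Local Notation vcvg := (vcvg abs).
Local Notation q := #|F|.

Lemma vcvgP s y : vcvg s y <->
  forall eps, 0 < eps -> exists N, forall n, (N <= n)%N -> abs (s n - y) < eps.
Proof.
rewrite /Defs.vcvg; split.
  move=> /cvgr0Pnorm_lt h eps e0; have [N _ hN] := h eps e0.
  by exists N => n /hN /=; rewrite ger0_norm.
move=> h; apply/cvgr0Pnorm_lt => eps e0; have [N hN] := h eps e0.
by exists N => // n /= Nn; rewrite ger0_norm // hN.
Qed.

Lemma vcvg_dist_le s y c B N : 0 <= B -> vcvg s y ->
  (forall n, (N <= n)%N -> abs (s n - c) <= B) -> abs (y - c) <= B.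
Proof.
move=> B0 /vcvgP h hB; rewrite leNgt; apply/negP => yB.
have [|M hM] := h (abs (y - c)); first exact: le_lt_trans yB.
pose n := maxn N M.
have : abs (y - c) < abs (y - c).
  rewrite -{1}(subrKA (s n)) ultraD_lt //.
    by rewrite abs_distC hM // leq_maxr.
  by apply: le_lt_trans yB; apply: hB; rewrite leq_maxl.
by rewrite ltxx.
Qed.

Lemma vcvg_uniq s y y' : vcvg s y -> vcvg s y' -> y = y'.
Proof.
move=> h /vcvgP h'; apply/eqP; rewrite -subr_eq0 -abs_eq0b eq_le a_ge0 andbT.
apply/ler_addgt0Pr => eps e0; rewrite add0r.
have [N hN] := h' _ e0; apply: (vcvg_dist_le (N := N)) h _ => [|n /hN]; exact: ltW.
Qed.

Lemma vlimE s y : vcvg s y -> vlim abs s = y.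
Proof.
move=> h; rewrite /vlim; case: xgetP => [w _ hw|/(_ y)//].
exact: vcvg_uniq hw h.
Qed.

Lemma expq_additive (x y : C) : (x + y) ^+ q = x ^+ q + y ^+ q.
Proof.
have [p p_pr pF] := finPcharP F.
have pC : p \in [pchar C].
  apply: (rmorph_pchar iota); apply: (rmorph_pchar (@FracField.tofrac _)).
  exact: (rmorph_pchar polyC).
apply: exprDn_pchar.
have := abelem_pgroup (fin_ring_pchar_abelem pF); rewrite /pgroup cardsT.
by apply: sub_in_pnat => r _; rewrite inE => /eqP ->.
Qed.

Lemma expq_sub (x y : C) : (x - y) ^+ q = x ^+ q - y ^+ q.
Proof. by apply: (addIr (y ^+ q)); rewrite -expq_additive !subrK. Qed.

Lemma expq_sum (n : nat) (g : nat -> C) :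
  (\sum_(i < n) g i) ^+ q = \sum_(i < n) g i ^+ q.
Proof.
elim: n => [|n IHn]; last by rewrite !big_ord_recr /= expq_additive IHn.
by rewrite !big_ord0 expr0n gtn_eqF // ltnW // card_gt1.
Qed.

Lemma size_bracket i : (0 < i)%N -> size (carlitz_bracket F i) = (q ^ i).+1.
Proof.
move=> i0; rewrite /carlitz_bracket size_polyDl size_polyXn // size_polyN size_polyX.
by have := ltn_expl i card_gt1; lia.
Qed.

Lemma abs_bracket i : (0 < i)%N -> abs (inA (carlitz_bracket F i)) = Q ^+ (q ^ i).
Proof. by move=> i0; rewrite abs_inA -?size_poly_gt0 size_bracket. Qed.

Lemma abs_carlitz_d i : abs (inA (carlitz_d F i)) = Q ^+ (i * q ^ i).
Proof.
rewrite /carlitz_d inA_prod abs_prod.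
rewrite (eq_bigr (fun=> Q ^+ (q ^ i))) => [|j _].
  by rewrite prodr_const card_ord -exprM mulnC.
rewrite inA_X absX abs_bracket ?subn_gt0 // -exprM -expnD subnK //.
exact: ltnW.
Qed.

Lemma carlitz_d_neq0 i : inA (carlitz_d F i) != 0.
Proof. by rewrite -abs_gt0 abs_carlitz_d exprn_gt0 ?Q_gt0. Qed.

Lemma carlitz_dS i : carlitz_d F i.+1 = carlitz_bracket F i.+1 * carlitz_d F i ^+ q.
Proof.
rewrite /carlitz_d big_ord_recl /= subn0 expn0 expr1; congr (_ * _).
rewrite -prodrXl; apply: eq_bigr => j _; rewrite -exprM -expnSr.
by rewrite /bump /= add1n subSS.
Qed.

Definition carlitz_term (x : C) (i : nat) : C := x ^+ (q ^ i) / inA (carlitz_d F i).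
Definition carlitz_sum (x : C) (n : nat) : C := \sum_(i < n) carlitz_term x i.
Local Notation e_car := (carlitz_exp iota abs).

Lemma abs_carlitz_term x i : abs (carlitz_term x i) = (abs x / Q ^+ i) ^+ (q ^ i).
Proof. by rewrite /carlitz_term abs_div absX abs_carlitz_d expr_div_n exprM. Qed.

Lemma ultra_cauchy (s : nat -> C) :
  (forall eps, 0 < eps -> exists N, forall n, (N <= n)%N -> abs (s n) < eps) ->
  exists y, vcvg (fun n => \sum_(i < n) s i) y.
Proof.
move=> h; apply: (abs_complete HC) => eps e0; have [N hN] := h eps e0; exists N.
have main m n : (N <= m)%N -> (m <= n)%N ->
    abs (\sum_(i < n) s i - \sum_(i < m) s i) < eps.
  move=> Nm; elim: n => [|n IHn].
    by rewrite leqn0 => /eqP ->; rewrite subrr abs0.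
  rewrite leq_eqVlt => /orP[/eqP ->|mn]; first by rewrite subrr abs0.
  rewrite big_ord_recr /= addrAC ultraD_lt ?IHn // hN //.
  by apply: (leq_trans Nm).
move=> m n Nm Nn; have [mn|/ltnW nm] := leqP m n; last exact: main.
by rewrite abs_distC main.
Qed.

Lemma carlitz_exp_cvg x : vcvg (carlitz_sum x) (e_car x).
Proof.
suff [y hy] : exists y, vcvg (carlitz_sum x) y by rewrite /carlitz_exp (vlimE hy).
apply: ultra_cauchy => eps e0.
have [k hk] := Qn_unbounded (abs x * Q).
have [k' hk'] := Qn_unbounded eps^-1.
exists (k + k')%N => n kn; rewrite abs_carlitz_term.
have h1 : abs x / Q ^+ n <= Q^-1.
  rewrite ler_pdivrMr ?exprn_gt0 ?Q_gt0 // mulrC ler_pdivlMr ?Q_gt0 //.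
  by apply: (le_trans (ltW hk)); rewrite ler_eXn2l ?Q_gt1 //; lia.
have h2 : (abs x / Q ^+ n) ^+ (q ^ n) <= Q^-1 ^+ (q ^ n).
  by rewrite lerXn2r // nnegrE ?divr_ge0 ?invr_ge0 ?exprn_ge0 ?Q_ge0.
apply: (le_lt_trans h2); rewrite exprVn invf_plt ?posrE ?exprn_gt0 ?Q_gt0 //.
apply: (lt_le_trans hk'); rewrite ler_eXn2l ?Q_gt1 //.
by have := ltn_expl n card_gt1; lia.
Qed.

Lemma carlitz_sum_theta x n : carlitz_sum (inA 'X * x) n.+1 =
  inA 'X * carlitz_sum x n.+1 + carlitz_sum x n ^+ q.
Proof.
rewrite /carlitz_sum expq_sum mulr_sumr big_ord_recl [in RHS]big_ord_recl /=.
rewrite -addrA -big_split /=; congr (_ + _).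
  by rewrite /carlitz_term expn0 !expr1 mulrA.
apply: eq_bigr => i _; rewrite /bump /= add1n /carlitz_term carlitz_dS inA_M inA_X.
have d0 := carlitz_d_neq0 i.
have b0 : inA (carlitz_bracket F i.+1) != 0.
  by rewrite -abs_gt0 abs_bracket // exprn_gt0 ?Q_gt0.
rewrite exprMn [in RHS]expr_div_n -exprM -expnSr.
have E : inA 'X ^+ (q ^ i.+1) = inA (carlitz_bracket F i.+1) + inA 'X.
  by rewrite /carlitz_bracket inA_B inA_X subrK.
rewrite E; field.
by rewrite b0 expf_neq0.
Qed.

Lemma carlitz_exp_theta x : e_car (inA 'X * x) = inA 'X * e_car x + e_car x ^+ q.
Proof.
apply: vcvg_uniq (carlitz_exp_cvg _) _; apply/vcvgP => eps e0.
have /vcvgP h := carlitz_exp_cvg x.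
have [N1 h1] : exists N, forall n, (N <= n)%N ->
    abs (carlitz_sum x n - e_car x) < Num.min 1 eps.
  by apply: h; rewrite lt_min ltr01.
have [N2 h2] := h (eps / Q) (divr_gt0 e0 Q_gt0).
exists (N1 + N2).+1 => -[//|n] Nn; rewrite carlitz_sum_theta opprD addrACA.
rewrite -mulrBr -expq_sub ultraD_lt //.
  by rewrite a_M abs_theta mulrC -ltr_pdivlMr ?Q_gt0 // h2 //; lia.
rewrite absX; have := h1 n; rewrite lt_min => /(_ _)/andP[|a1 a2]; first lia.
apply: le_lt_trans a2; rewrite -[leRHS]expr1 ler_wiXn2l ?a_ge0 ?(ltW a1) //.
by rewrite ltnW // card_gt1.
Qed.

Definition geom (n : nat) : nat := \sum_(i < n) q ^ i.

Lemma geomS n : geom n.+1 = (geom n + q ^ n)%N.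
Proof. by rewrite /geom big_ord_recr. Qed.

Lemma geom_rec n : geom n.+1 = (1 + q * geom n)%N.
Proof.
rewrite /geom big_ord_recl expn0 big_distrr /=; congr (_ + _)%N.
by apply: eq_bigr => i _; rewrite /bump /= add1n expnS.
Qed.

Lemma predq_geom n : (q.-1 * geom n = (q ^ n).-1)%N.
Proof.
have := geom_rec n; rewrite geomS; have := card_gt1.
have := expn_gt0 q n; rewrite (ltnW card_gt1) /=.
by case: #|F| => // k; rewrite /= => *; nia.
Qed.

Lemma geom_le i : (2 <= i)%N -> (geom i.+1 <= i * q ^ i)%N.
Proof.
have q1 := card_gt1.
case: i => [|[|i]] // _; elim: i => [|i IHi].
  by rewrite !geomS /geom big_ord0 !expnS expn0; nia.
rewrite geomS; apply: (leq_trans (leq_add IHi (leqnn _))).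
by rewrite [(q ^ i.+3)%N]expnS; nia.
Qed.

Lemma abs_carlitz_term_le x i (c : R) : (0 < i)%N -> 0 <= c <= 1 ->
  abs x ^+ q.-1 <= c * Q ^+ q -> abs (carlitz_term x i) <= abs x * c.
Proof.
move=> i0 /andP[c0 c1] hx.
rewrite abs_carlitz_term expr_div_n -exprM.
have qi : (q ^ i = (q.-1 * geom i).+1)%N.
  by rewrite predq_geom prednK // expn_gt0 (ltnW card_gt1).
have gi : (q * geom i <= i * q ^ i)%N.
  have [->|i1] := eqVneq i 1%N; first by rewrite /geom big_ord1 expn0 expn1; lia.
  by have := @geom_le i; rewrite geom_rec; lia.
rewrite [in X in X / _]qi exprS -mulrA ler_wpM2l ?a_ge0 //.
rewrite ler_pdivrMr ?exprn_gt0 ?Q_gt0 // exprM.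
apply: (@le_trans _ _ ((c * Q ^+ q) ^+ geom i)).
  by rewrite lerXn2r // nnegrE ?exprn_ge0 ?mulr_ge0 ?a_ge0 ?exprn_ge0 ?Q_ge0.
rewrite exprMn -exprM ler_pM ?exprn_ge0 ?Q_ge0 //; last first.
  by rewrite ler_eXn2l ?Q_gt1.
rewrite -[leRHS]expr1 ler_wiXn2l //.
by case: (i) i0 => // j _; rewrite geom_rec.
Qed.

Lemma abs_carlitz_term_le2 x i : (2 <= i)%N ->
  abs x ^+ q.-1 <= Q ^+ q -> abs (carlitz_term x i) <= abs x / Q.
Proof.
move=> i2 hx; rewrite abs_carlitz_term expr_div_n -exprM.
have qi : (q ^ i = (q.-1 * geom i).+1)%N.
  by rewrite predq_geom prednK // expn_gt0 (ltnW card_gt1).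
rewrite [in X in X / _]qi exprS -mulrA ler_wpM2l ?a_ge0 //.
rewrite ler_pdivrMr ?exprn_gt0 ?Q_gt0 // exprM mulrC ler_pdivlMr ?Q_gt0 //.
apply: (@le_trans _ _ ((Q ^+ q) ^+ geom i * Q)).
  rewrite ler_wpM2r ?Q_ge0 // lerXn2r // nnegrE ?exprn_ge0 ?a_ge0 ?Q_ge0 //.
by rewrite -exprM -exprSr ler_eXn2l ?Q_gt1 // -add1n -geom_rec geom_le.
Qed.

Lemma carlitz_exp_small x : abs x ^+ q.-1 < Q ^+ q -> abs (e_car x) = abs x.
Proof.
have [->|x0] := eqVneq x 0.
  move=> _; have -> : e_car 0 = 0.
    apply: vcvg_uniq (carlitz_exp_cvg 0) _; apply/vcvgP => eps e0; exists 0%N => n _.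
    rewrite subr0 /carlitz_sum big1 ?abs0 // => i _.
    by rewrite /carlitz_term expr0n gtn_eqF ?mul0r // expn_gt0 ltnW // card_gt1.
  by [].
move=> hx; pose c := abs x ^+ q.-1 / Q ^+ q.
have Qq : 0 < Q ^+ q by rewrite exprn_gt0 ?Q_gt0.
have c1 : c < 1 by rewrite ltr_pdivrMr ?mul1r.
have c0 : 0 <= c by rewrite divr_ge0 ?exprn_ge0 ?a_ge0 ?Q_ge0.
have ax : 0 < abs x by rewrite abs_gt0.
have h : abs (e_car x - x) <= abs x * c.
  apply: (vcvg_dist_le (N := 1%N)) (carlitz_exp_cvg x) _.
    by rewrite mulr_ge0 ?a_ge0.
  move=> [//|n] _; rewrite /carlitz_sum big_ord_recl /= {1}/carlitz_term.
  rewrite expn0 expr1 /carlitz_d big_ord0 inA1 divr1 addrC addKr.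
  apply: ultra_sum; first by rewrite mulr_ge0 ?a_ge0.
  move=> i _; apply: abs_carlitz_term_le => //; first by rewrite c0 ltW.
  by rewrite /c divfK // gt_eqF.
rewrite -(subrK x (e_car x)) addrC abs_dom //.
by apply: (le_lt_trans h); rewrite -[ltRHS]mulr1 ltr_pM2l.
Qed.

Lemma carlitz_exp_boundary x : x != 0 -> abs x ^+ q.-1 <= Q ^+ q ->
  abs (e_car x - (x + x ^+ q / inA (carlitz_d F 1))) <= abs x / Q.
Proof.
move=> x0 hx.
have B0 : 0 <= abs x / Q by rewrite divr_ge0 ?a_ge0 ?Q_ge0.
apply: (vcvg_dist_le (N := 2%N) B0 (carlitz_exp_cvg x)).
move=> [//|[//|n]] _; rewrite /carlitz_sum 2!big_ord_recl /= {1 2}/carlitz_term.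
rewrite expn0 expr1 {1}/carlitz_d big_ord0 inA1 divr1 /bump /= addn0 expn1.
set T := \sum_(_ < n) _; rewrite (_ : _ - _ = T); last by ring.
apply: ultra_sum => // i _; exact: abs_carlitz_term_le2.
Qed.

Lemma carlitz_exp_growth y k : Q < abs (e_car y) ^+ q.-1 ->
  abs (e_car (inA 'X ^+ k * y)) = abs (e_car y) ^+ (q ^ k).
Proof.
move=> hy; elim: k => [|k IHk]; first by rewrite mul1r.
rewrite exprS -mulrA carlitz_exp_theta; set w := e_car _ in IHk *.
have q1 := card_gt1.
have y1 : 1 <= abs (e_car y).
  rewrite leNgt; apply/negP => y1; move: hy; rewrite ltNge => /negP; apply.
  apply: (@le_trans _ _ 1); last by rewrite ltW ?Q_gt1.
  by rewrite exprn_ile1 ?a_ge0 // ltW.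
have hw : Q < abs w ^+ q.-1.
  rewrite IHk -exprM mulnC exprM; apply: (lt_le_trans hy).
  rewrite -[leLHS]expr1 ler_weXn2l //.
    by rewrite exprn_ege1.
  by rewrite expn_gt0 (ltnW q1).
have w0 : 0 < abs w.
  by rewrite IHk exprn_gt0 // (lt_le_trans ltr01).
rewrite addrC abs_dom; first by rewrite absX IHk -exprM -expnSr.
by rewrite a_M abs_theta absX [X in _ ^+ X]card_pred exprSr ltr_pM2r.
Qed.

Lemma genpoly_horner (z : C) : z ^+ q - z = \prod_(b : F) (z - inA b%:P).
Proof.
pose g : {rmorphism F -> C} := iota \o (@FracField.tofrac _) \o polyC.
have := congr1 (fun p => (map_poly g p).[z]) (finField_genPoly F).
rewrite /= rmorphB /= map_polyXn map_polyX !hornerE => ->.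
rewrite rmorph_prod /= horner_prod; apply: eq_bigr => b _.
by rewrite rmorphB /= map_polyX map_polyC /= !hornerE.
Qed.

Lemma fib0_const z b : fib 0 0 z -> abs (z - inA b%:P) = 1.
Proof.
move=> fz; rewrite -/(Defs.inA iota _) (fib_abs (FracField.tofrac b%:P) fz).
by rewrite oppr0 expr0z rmorph0 sub0r absN; apply/max_idPl; apply: abs_const_le.
Qed.

Lemma fib0_genpoly z : fib 0 0 z -> abs (z ^+ q - z) = 1.
Proof.
move=> fz; rewrite genpoly_horner abs_prod big1 // => b _; exact: fib0_const.
Qed.

Lemma fib0_abs z : fib 0 0 z -> abs z = 1.
Proof. by move=> fz; have := fib0_const 0 fz; rewrite inA0 subr0. Qed.

Lemma fib_scale (n : nat) z : fib 0 (- n%:Z) z -> fib 0 0 (z / inA 'X ^+ n).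
Proof.
have t0 : inA 'X ^+ n != 0 by rewrite expf_neq0 // inA_eq0 polyX_eq0.
have Qn : 0 < Q ^+ n by rewrite exprn_gt0 ?Q_gt0.
move=> [h1 h2]; split.
  move: h1; rewrite rmorph0 !subr0 opprK oppr0 expr0z abs_div absX abs_theta => h1.
  by rewrite ler_pdivrMr // mul1r.
move=> s; have := h2 (FracField.tofrac 'X ^+ n * s).
rewrite opprK oppr0 expr0z rmorphM rmorphXn /= -/(Defs.inA iota 'X) => h.
have -> : z / inA 'X ^+ n - iota s = (z - inA 'X ^+ n * iota s) / inA 'X ^+ n.
  by field.
by rewrite abs_div absX abs_theta ler_pdivlMr // mul1r.
Qed.

(* The period is theta^N x0 with |x0| on the critical radius |x0|^(q-1) = q^q. There
   e(x0 z') is x0 (z' - z'^q) up to smaller terms, and beyond that radius e(y)^q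
   dominates in e(theta y) = theta e(y) + e(y)^q. *)
Lemma carlitz_period_growth varpi : varpi != 0 -> is_carlitz_period iota abs varpi ->
  exists M : nat, (0 < M)%N /\ forall (n : nat) z, fib 0 (- n%:Z) z ->
    abs (e_car (varpi * z)) ^+ q.-1 = Q ^+ (q ^ (M + n)).
Proof.
move=> v0 per; have q1 := card_gt1.
have ev : e_car varpi = 0 by apply/per; exists 1; rewrite inA1 mulr1.
have av : 0 < abs varpi by rewrite abs_gt0.
have X0 : inA 'X != 0 by rewrite inA_eq0 polyX_eq0.
have ev_large : Q ^+ q <= abs varpi ^+ q.-1.
  rewrite leNgt; apply/negP => /carlitz_exp_small; rewrite ev abs0 => /esym/eqP.
  by rewrite gt_eqF.
have exN : exists N, (abs varpi / Q ^+ N) ^+ q.-1 < Q ^+ q.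
  have [N hN] := Qn_unbounded (abs varpi); exists N.
  apply: (@le_lt_trans _ _ 1); last by rewrite exprn_egt1 ?Q_gt1 //; lia.
  rewrite exprn_ile1 ?divr_ge0 ?a_ge0 ?exprn_ge0 ?Q_ge0 //.
  by rewrite ler_pdivrMr ?exprn_gt0 ?Q_gt0 // mul1r ltW.
case: (ex_minnP exN) => -[|N]; first by rewrite expr0 divr1 ltNge ev_large.
move=> hN1 hmin; have hN : Q ^+ q <= (abs varpi / Q ^+ N) ^+ q.-1.
  by rewrite leNgt; apply/negP => /hmin; rewrite ltnn.
pose x0 := varpi / inA 'X ^+ N; pose x1 := varpi / inA 'X ^+ N.+1.
have ax0 : abs x0 = abs varpi / Q ^+ N by rewrite abs_div absX abs_theta.
have ax1 : abs x1 = abs varpi / Q ^+ N.+1 by rewrite abs_div absX abs_theta.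
have ax01 : abs x0 = Q * abs x1.
  by rewrite ax0 ax1 exprS; field; rewrite Q_neq0 expf_neq0 ?Q_neq0.
have v1 : varpi = inA 'X ^+ N.+1 * x1 by rewrite mulrC divfK // expf_neq0.
have vv0 : varpi = inA 'X ^+ N * x0 by rewrite mulrC divfK // expf_neq0.
have nogrow k y : varpi = inA 'X ^+ k * y -> abs (e_car y) ^+ q.-1 <= Q.
  move=> vy; rewrite leNgt; apply/negP => hy.
  have := carlitz_exp_growth k hy; rewrite -vy ev abs0 => /esym/eqP.
  rewrite expf_eq0 => /andP[_ /eqP y0]; move: hy.
  by rewrite y0 expr0n gtn_eqF ?ltNge ?Q_ge0 //; lia.
have x1Q : abs x1 ^+ q.-1 = Q.
  apply/le_anti/andP; split.
    rewrite -(carlitz_exp_small (x := x1)) ?ax1 //; exact: nogrow v1.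
  rewrite -(@ler_pM2l _ (Q ^+ q.-1)) ?exprn_gt0 ?Q_gt0 //.
  rewrite -exprSr -card_pred; apply: (le_trans hN).
  by rewrite -ax0 ax01 exprMn.
have x0Q : abs x0 ^+ q.-1 = Q ^+ q.
  by rewrite ax01 exprMn x1Q -exprSr -card_pred.
have x0n : x0 != 0 by rewrite mulf_neq0 ?invr_neq0 ?expf_neq0.
have ax0_gt : 0 < abs x0 by rewrite abs_gt0.
have Qq : Q < Q ^+ q by rewrite -[ltLHS]expr1 ltr_eXn2l ?Q_gt1.
have ex0 : abs (e_car x0) < abs x0.
  rewrite ltNge; apply/negP => h; have := nogrow _ _ vv0.
  rewrite leNgt => /negP; apply; apply: (lt_le_trans Qq); rewrite -x0Q.
  by rewrite lerXn2r // nnegrE a_ge0.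
exists N.+1; split=> // n z fz.
pose z' := z / inA 'X ^+ n; have fz' : fib 0 0 z' := fib_scale fz.
have zz : z = inA 'X ^+ n * z' by rewrite mulrC divfK // expf_neq0.
clearbody x0 z'.
have z1 := fib0_abs fz'.
have axz : abs (x0 * z') = abs x0 by rewrite a_M z1 mulr1.
have lt_small : abs x0 / Q < abs x0 by rewrite ltr_pdivrMr ?Q_gt0 // ltr_pMr ?Q_gt1.
have b0 := carlitz_exp_boundary x0n; rewrite x0Q lexx in b0; have {}b0 := b0 isT.
have bz : abs (e_car (x0 * z') - (x0 * z' + (x0 * z') ^+ q / inA (carlitz_d F 1)))
    <= abs x0 / Q.
  rewrite -axz; apply: carlitz_exp_boundary; last by rewrite axz x0Q.
  by rewrite mulf_neq0 // -abs_gt0 z1.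
have main : abs (e_car (x0 * z') - x0 * (z' - z' ^+ q)) < abs x0.
  set d1 := inA (carlitz_d F 1) in b0 bz.
  have -> : e_car (x0 * z') - x0 * (z' - z' ^+ q) =
     (e_car (x0 * z') - (x0 * z' + (x0 * z') ^+ q / d1)) -
     z' ^+ q * (e_car x0 - (x0 + x0 ^+ q / d1)) + z' ^+ q * e_car x0.
    by rewrite exprMn; ring.
  have zq : abs (z' ^+ q) = 1 by rewrite absX z1 expr1n.
  apply: ultraD_lt; first apply: ultraB_lt.
  - exact: le_lt_trans bz lt_small.
  - by rewrite a_M zq mul1r; apply: le_lt_trans b0 lt_small.
  - by rewrite a_M zq mul1r.
have axz' : abs (e_car (x0 * z')) = abs x0.
  have hz : abs (x0 * (z' - z' ^+ q)) = abs x0.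
    by rewrite a_M abs_distC fib0_genpoly // mulr1.
  by rewrite -(subrK (x0 * (z' - z' ^+ q)) (e_car _)) addrC abs_dom hz.
have -> : varpi * z = inA 'X ^+ (N + n) * (x0 * z').
  by rewrite exprD [in LHS]vv0 [in LHS]zz; ring.
rewrite carlitz_exp_growth axz' ?x0Q // -exprM mulnC exprM x0Q -exprM.
by rewrite -expnS addSn.
Qed.

Local Notation uparam := (uparam iota abs).

Lemma carlitz_exp0 : e_car 0 = 0.
Proof.
have := @carlitz_exp_small 0; rewrite abs0 expr0n => h.
apply/eqP; rewrite -abs_eq0b h //; case: eqP => _; last by rewrite exprn_gt0 ?Q_gt0.
by rewrite exprn_egt1 ?Q_gt1 //; have := card_gt1; lia.
Qed.

Lemma uparam_growth varpi : varpi != 0 -> is_carlitz_period iota abs varpi ->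
  exists M : nat, (0 < M)%N /\ forall (n : nat) z, fib 0 (- n%:Z) z ->
    0 < abs (uparam varpi z) /\
    lg (abs (uparam varpi z)) = - ((q ^ (M + n))%:R / (q%:R - 1)).
Proof.
move=> v0 per; have [M [M0 hM]] := carlitz_period_growth v0 per.
have q1 := card_gt1.
exists M; split=> // n z /hM h.
have e0 : 0 < abs (e_car (varpi * z)).
  rewrite abs_gt0; apply/eqP => e0; move: h; rewrite e0 abs0 expr0n.
  rewrite gtn_eqF ?(ltn_predRL 0) // => /esym/eqP.
  by rewrite gt_eqF // exprn_gt0 ?Q_gt0.
rewrite /Defs.uparam absV invr_gt0; split=> //.
have := congr1 lg h; rewrite lgXn // exprnP lgQz.
have q10 : q%:R - 1 != 0 :> R by rewrite subr_eq0 gt_eqF // Q_gt1.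
have -> : (q.-1)%:R = q%:R - 1 :> R by rewrite [in RHS]card_pred -natr1 addrK.
rewrite -[_%:~R]/((q ^ (M + n))%:R) => <-.
by rewrite [_ * lg _]mulrC mulfK // /lg lnV ?mulNr ?posrE.
Qed.

Lemma series_terms_bounded (a : nat -> C) (x y : C) :
  vcvg (fun n => \sum_(i < n) a i * x ^+ i) y ->
  exists B, 0 < B /\ forall i, abs (a i * x ^+ i) <= B.
Proof.
move=> /vcvgP /(_ 1 ltr01)[N hN].
have B0 : 0 <= \sum_(i < N) abs (a i * x ^+ i) by apply: sumr_ge0.
exists (1 + \sum_(i < N) abs (a i * x ^+ i)); split; first by rewrite ltr_wpDr.
move=> i; have [iN|Ni] := ltnP i N.
  rewrite (bigD1 (Ordinal iN)) //= addrCA lerDl addr_ge0 // sumr_ge0 //.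
have -> : a i * x ^+ i = (\sum_(j < i.+1) a j * x ^+ j - y) -
    (\sum_(j < i) a j * x ^+ j - y) by rewrite big_ord_recr /=; ring.
apply: (@le_trans _ _ 1); last by rewrite lerDl.
by rewrite ltW // ultraB_lt // hN // leqW.
Qed.

Lemma expansion_bound varpi f a nu : varpi != 0 -> is_carlitz_period iota abs varpi ->
  u_expansion iota abs varpi f a -> (forall i, (i < nu)%N -> a i = 0) ->
  exists B (n0 : nat), 0 < B /\ forall (n : nat) z, (n0 <= n)%N -> fib 0 (- n%:Z) z ->
    abs (f z) <= B * abs (uparam varpi z) ^+ nu.
Proof.
move=> v0 per [eps eps0 hexp] a0.
have [M [M0 hM]] := uparam_growth v0 per.
have Q1 : 0 < q%:R - 1 :> R by rewrite subr_gt0 Q_gt1.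
have umono n n' z z' : (n <= n')%N -> fib 0 (- n%:Z) z -> fib 0 (- n'%:Z) z' ->
    abs (uparam varpi z') <= abs (uparam varpi z).
  move=> nn' /hM[p E] /hM[p' E']; rewrite -ler_lg // E E' lerN2 ler_pM2r ?invr_gt0 //.
  by rewrite ler_nat leq_exp2l ?card_gt1 // leq_add2l.
have [n0 hn0] : exists n0 : nat, forall n z, (n0 <= n)%N -> fib 0 (- n%:Z) z ->
    abs (uparam varpi z) < eps.
  pose n0 := Num.bound (`|lg eps| * (q%:R - 1)).
  exists n0 => n z nn fz; have [p E] := hM n z fz.
  rewrite ltNge; apply/negP; rewrite -ler_lg // E => h.
  have h1 : `|lg eps| * (q%:R - 1) < n0%:R.
    by apply: archi_boundP; rewrite mulr_ge0 // ltW.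
  have h2 : (q ^ (M + n))%:R / (q%:R - 1) <= `|lg eps|.
    by rewrite -normrN; apply: le_trans (ler_norm _); rewrite lerNr.
  move: h2; rewrite ler_pdivrMr // => h2.
  have := le_lt_trans h2 h1; rewrite ltr_nat.
  by have := ltn_expl (M + n) card_gt1; lia.
have [z1 fz1] := fib_nonempty 0 (- n0%:Z).
have [u1 _] := hM _ _ fz1.
have [B0 [B00 hB]] := series_terms_bounded (hexp z1 (fib_Omega fz1) (hn0 _ _ (leqnn _) fz1)).
exists (B0 / abs (uparam varpi z1) ^+ nu), n0; split; first by rewrite divr_gt0 ?exprn_gt0.
move=> n z nn fz; have hc := hexp z (fib_Omega fz) (hn0 _ _ nn fz).
have um := umono _ _ _ _ nn fz1 fz; have [u0 _] := hM _ _ fz.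
rewrite -[f z]subr0; apply: (vcvg_dist_le (N := 0%N)) hc _.
  by rewrite mulr_ge0 ?divr_ge0 ?exprn_ge0 ?a_ge0 // ltW.
move=> N _; rewrite subr0; apply: ultra_sum.
  by rewrite mulr_ge0 ?divr_ge0 ?exprn_ge0 ?a_ge0 // ltW.
move=> i _; have [inu|nui] := ltnP i nu.
  by rewrite a0 // mul0r abs0 mulr_ge0 ?divr_ge0 ?exprn_ge0 ?a_ge0 // ltW.
have E : abs (a i * uparam varpi z ^+ i) = abs (a i * uparam varpi z1 ^+ i) *
    (abs (uparam varpi z) / abs (uparam varpi z1)) ^+ i.
  by rewrite !a_M !absX expr_div_n mulrA mulrAC mulfK ?gt_eqF ?exprn_gt0.
rewrite E mulrAC -mulrA -expr_div_n ler_pM ?a_ge0 ?exprn_ge0 ?divr_ge0 //.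
by rewrite ler_wiXn2l ?divr_ge0 // ler_pdivrMr // mul1r.
Qed.

Lemma u_expansion_period0 f a z :
  u_expansion iota abs 0 f a -> Omega z -> f z = a 0.
Proof.
move=> [eps eps0 h] Oz.
have uz : uparam 0 z = 0 by rewrite /Defs.uparam mul0r carlitz_exp0 invr0.
have := h z Oz; rewrite uz abs0 => /(_ eps0) hz.
apply: vcvg_uniq hz _; apply/vcvgP => e e0; exists 1%N => -[//|k] _.
rewrite big_ord_recl expr0 mulr1 big1 ?addr0 ?subrr ?abs0 // => i _.
by rewrite expr0n mulr0.
Qed.

Lemma bounded_infty varpi f : is_carlitz_period iota abs varpi ->
  holomorphic_infty iota abs varpi f ->
  exists B (n0 : nat), 0 < B /\ forall (n : nat) z, (n0 <= n)%N -> fib 0 (- n%:Z) z ->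
    abs (f z) <= B.
Proof.
move=> per [_ [a ha]]; have [v0|v0] := eqVneq varpi 0; last first.
  have [//|B [n0 [B0 h]]] := expansion_bound (nu := 0) v0 per ha.
  by exists B, n0; split=> // n z nn fz; have := h n z nn fz; rewrite expr0 mulr1.
exists (abs (a 0) + 1), 0%N; split; first by rewrite ltr_wpDl ?a_ge0.
move=> n z _ /fib_Omega Oz; rewrite v0 in ha.
by rewrite (u_expansion_period0 ha Oz) lerDl.
Qed.

Lemma phi_vertex_le varpi f e (n : nat) : is_carlitz_period iota abs varpi ->
  holomorphic f -> 0 < e -> holomorphic_infty iota abs varpi f ->
  phi f e 0 (- n%:Z) <= phi f e 0 0.
Proof.
move=> per hf e0 hi; have [pf _] := hi; have [B [n0 [B0 hB]]] := bounded_infty per hi.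
pose u k := phi f e 0 (- k%:Z).
have hu k : (q%:R + 1) * u k.+1 <= u k.+2 + q%:R * u k.
  have := phi_periodic_subharmonic hf e0 pf k.+1.
  by rewrite (_ : - k.+1%:Z + 1 = - k%:Z) //; lia.
have := @convex_bounded u q%:R (lg (B + e)) n0 (ltW Q_gt1) hu; apply.
move=> k nk; apply: phi_le => //; rewrite ?addr_gt0 ?lerDr ?(ltW B0) //.
by move=> z fz; rewrite (le_trans (hB _ _ nk fz)) // lerDl ltW.
Qed.

Lemma phi_order varpi f a nu : varpi != 0 -> is_carlitz_period iota abs varpi ->
  holomorphic f -> u_expansion iota abs varpi f a -> (forall i, (i < nu)%N -> a i = 0) ->
  exists (B : R) (n0 : nat), forall (n : nat) e, (n0 <= n)%N -> 0 < e ->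
    lg e = B - nu%:R * ((q ^ n.+1)%:R / (q%:R - 1)) -> phi f e 0 (- n%:Z) <= lg e.
Proof.
move=> v0 per hf ha a0; have [B [n0 [B0 hB]]] := expansion_bound v0 per ha a0.
have [M [M0 hM]] := uparam_growth v0 per.
have Q1 : 0 < q%:R - 1 :> R by rewrite subr_gt0 Q_gt1.
exists (lg B), n0 => n e nn e0 le; apply: phi_le => // z fz.
apply: (le_trans (hB n z nn fz)); have [u0 E] := hM n z fz.
have un : 0 < abs (uparam varpi z) ^+ nu by rewrite exprn_gt0.
rewrite -ler_lg ?mulr_gt0 // lgM // lgXn // E le lerD2l mulrN lerN2 ler_wpM2l //.
rewrite ler_pM2r ?invr_gt0 // ler_nat leq_exp2l ?card_gt1 //.
by rewrite -add1n leq_add2r.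
Qed.

(** * Reduction modulo SL_2(A) *)

Lemma Omega_not_K z s : Omega z -> z - iota s != 0.
Proof.
move=> Oz; apply/eqP => zs; apply: Oz => eps e0; exists s.
by rewrite zs abs0.
Qed.

Definition lin (c d : {poly F}) (z : C) : C := inA c * z + inA d.

Lemma lin_factor c d z : c != 0 -> exists s, lin c d z = inA c * (z - iota s).
Proof.
move=> c0; exists (- (FracField.tofrac d / FracField.tofrac c)).
rewrite rmorphN opprK rmorphM fmorphV mulrDr mulrCA divff ?mulr1 //.
by rewrite -/(Defs.inA iota c) inA_eq0.
Qed.

Lemma lin_neq0 c d z : Omega z -> (c != 0) || (d != 0) -> lin c d z != 0.
Proof.
move=> Oz; have [->|c0 _] := eqVneq c 0.
  by rewrite /= /lin inA0 mul0r add0r inA_eq0.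
have [s ->] := lin_factor d z c0.
by rewrite mulf_neq0 ?inA_eq0 ?Omega_not_K.
Qed.

Lemma det_neq0 (a b c d : {poly F}) : a * d - b * c = 1 -> (c != 0) || (d != 0).
Proof.
move=> det; apply: contraT => /norP[/negbNE/eqP c0 /negbNE/eqP d0].
by move: det => /esym/eqP; rewrite c0 d0 !mulr0 subr0 oner_eq0.
Qed.

Section FibLin.
Variables (r : K) (m : int) (z : C).
Hypothesis fz : fib r m z.

Lemma lin_val c d : (c != 0) || (d != 0) -> exists k : int, abs (lin c d z) = Q ^ k.
Proof.
have [->|c0 _] := eqVneq c 0.
  by move=> /= d0; rewrite /lin inA0 mul0r add0r abs_inA //; exists (size d).-1.
have [s ->] := lin_factor d z c0; rewrite a_M (fib_abs s fz) abs_inA //.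
suff [k ->] : exists k : int, Num.max (Q ^ (- m)) (abs (iota r - iota s)) = Q ^ k.
  by exists ((size c).-1%:Z + k); rewrite expfzDr ?Q_neq0.
have [h|_] := leP (Q ^ (- m)) (abs (iota r - iota s)); last by exists (- m).
have [E|/iota_val[k]] := eqVneq (r - s) 0; last by rewrite rmorphB; exists k.
by move: h; rewrite -rmorphB E rmorph0 abs0 leNgt Qz_gt0.
Qed.

Lemma lin_ge c d : (c != 0) || (d != 0) -> Num.min 1 (Q ^ (- m)) <= abs (lin c d z).
Proof.
have [->|c0 _] := eqVneq c 0.
  by move=> /= d0; rewrite /lin inA0 mul0r add0r ge_min inA_ge1.
have [s ->] := lin_factor d z c0; rewrite a_M ge_min; apply/orP; right.
by rewrite -[leLHS]mul1r ler_pM ?ler01 ?Qz_ge0 ?inA_ge1 ?(fz.2 s).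
Qed.

Lemma lin_min : exists c d, (c != 0) || (d != 0) /\
  forall c' d', (c' != 0) || (d' != 0) -> abs (lin c d z) <= abs (lin c' d' z).
Proof.
pose E n := `[< exists c d, ((c != 0) || (d != 0)) /\
   abs (lin c d z) <= Q ^ (n%:Z - `|m|%:Z) >].
have E0 : exists n, E n.
  exists `|m|%N; apply/asboolP; exists 0, 1; rewrite oner_neq0 orbT; split=> //.
  by rewrite /lin inA0 mul0r add0r inA1 abs1 subrr expr0z.
case: (ex_minnP E0) => n /asboolP[c [d [cd h]]] hmin.
exists c, d; split=> // c' d' cd'; apply: (le_trans h).
have [k hk] := lin_val cd'; rewrite hk Qz_le leNgt; apply/negP => kn.
case: n h hmin kn => [|n] h hmin kn.
  have := lin_ge cd'; rewrite hk leNgt => /negP; apply.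
  rewrite lt_min -(expr0z Q) !Qz_lt; lia.
suff /hmin : E n by rewrite ltnn.
by apply/asboolP; exists c', d'; split=> //; rewrite hk Qz_le; lia.
Qed.

End FibLin.

Definition mob (a b c d : {poly F}) (z : C) : C := lin a b z / lin c d z.

Lemma lin_mob a b c d c1 d1 z : lin c d z != 0 ->
  lin c1 d1 (mob a b c d z) = lin (c1 * a + d1 * c) (c1 * b + d1 * d) z / lin c d z.
Proof.
by move=> h; rewrite /mob /lin !inA_D !inA_M; field.
Qed.

Lemma mob_translate a b c d a0 z : lin c d z != 0 ->
  mob (a + a0 * c) (b + a0 * d) c d z = mob a b c d z + inA a0.
Proof. by move=> h; rewrite /mob /lin !inA_D !inA_M; field. Qed.

(* (c, d) minimises |c z + d|, which makes the other entries reducible by translations. *)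
Lemma reduction r m z : fib r m z -> exists a b c d (j : nat),
  [/\ a * d - b * c = 1, fib 0 (- j%:Z) (mob a b c d z) &
      Num.min 1 (Q ^ (- m)) <= abs (lin c d z)].
Proof.
move=> fz; have Oz := fib_Omega fz.
have [c [d [cd hmin]]] := lin_min fz.
have cop : coprimep c d.
  have g0 : gcdp c d != 0 by rewrite gcdp_eq0 negb_and.
  have Ec := divpK (dvdp_gcdl c d); have Ed := divpK (dvdp_gcdr c d).
  set g := gcdp c d in g0 Ec Ed.
  have cd' : (c %/ g != 0) || (d %/ g != 0).
    apply: contraT => /norP[/negbNE/eqP c0 /negbNE/eqP d0].
    by move: cd; rewrite -Ec -Ed c0 d0 !mul0r eqxx.
  have El : lin c d z = inA g * lin (c %/ g) (d %/ g) z.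
    by rewrite -[in LHS]Ec -[in LHS]Ed /lin !inA_M; ring.
  have := hmin _ _ cd'; rewrite El a_M.
  have p0 : 0 < abs (lin (c %/ g) (d %/ g) z) by rewrite abs_gt0 lin_neq0.
  rewrite -[leRHS]mul1r ler_pM2r // abs_inA // -(expr0 Q) ler_eXn2l ?Q_gt1 //.
  rewrite /coprimep -/g; move: g0; rewrite -size_poly_gt0; case: (size g) => // -[|k] //.
have /Bezout_eq1_coprimepP[[u v] /= uv] := cop.
have l0 : lin c d z != 0 by apply: lin_neq0.
have al : 0 < abs (lin c d z) by rewrite abs_gt0.
have det : v * d - (- u) * c = 1 by rewrite -uv; ring.
set z0 := mob v (- u) c d z.
have key c1 d1 : (c1 != 0) || (d1 != 0) ->
    1 <= abs (lin c1 d1 z0) /\ exists k : int, abs (lin c1 d1 z0) = Q ^ k.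
  move=> cd1; rewrite lin_mob // abs_div.
  have cd2 : (c1 * v + d1 * c != 0) || (c1 * (- u) + d1 * d != 0).
    apply: contraT => /norP[/negbNE/eqP e1 /negbNE/eqP e2].
    have c10 : c1 = 0.
      have -> : c1 = (c1 * v + d1 * c) * d - (c1 * (- u) + d1 * d) * c.
        by rewrite -[LHS]mulr1 -det; ring.
      by rewrite e1 e2 !mul0r subr0.
    have d10 : d1 = 0.
      have -> : d1 = (c1 * (- u) + d1 * d) * v - (c1 * v + d1 * c) * (- u).
        by rewrite -[LHS]mulr1 -det; ring.
      by rewrite e1 e2 !mul0r subr0.
    by move: cd1; rewrite c10 d10 eqxx.
  split; first by rewrite ler_pdivlMr // mul1r hmin.
  have [k1 ->] := lin_val fz cd2; have [k2 ->] := lin_val fz cd.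
  by exists (k1 - k2); rewrite expfzDr ?Q_neq0 // invr_expz.
have z0E a0 : z0 + inA a0 = lin 1 a0 z0 by rewrite /lin inA1 mul1r.
pose E n := `[< exists a0, abs (z0 + inA a0) <= Q ^ n%:Z >].
have E0 : exists n, E n.
  have [n hn] := Qn_unbounded (abs z0); exists n; apply/asboolP; exists 0.
  by rewrite inA0 addr0 ltW.
case: (ex_minnP E0) => j /asboolP[a0 ha0] jmin.
have far a1 : Q ^ j%:Z <= abs (z0 + inA a1).
  have [|h1 [k hk]] := key 1 a1; first by rewrite oner_neq0.
  rewrite z0E hk Qz_le leNgt; apply/negP => kj.
  have k0 : 0 <= k by rewrite -Qz_le expr0z -hk.
  case: k k0 kj hk => // k _ kj hk.
  suff /jmin : E k by lia.
  by apply/asboolP; exists a1; rewrite z0E hk.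
exists (v + a0 * c), (- u + a0 * d), c, d, j; split.
- by rewrite -det; ring.
- rewrite mob_translate // -/z0; split; first by rewrite rmorph0 subr0 opprK.
  move=> s; rewrite opprK; have [a1 ha1] := iota_round s.
  have h1 : Q ^ j%:Z <= abs (z0 + inA a0 - inA a1) by rewrite -addrA -inA_B.
  have -> : z0 + inA a0 - iota s = (z0 + inA a0 - inA a1) - (iota s - inA a1) by ring.
  rewrite abs_domB //; apply: (lt_le_trans ha1); apply: le_trans h1.
  by rewrite -(expr0z Q) Qz_le.
- exact: (lin_ge fz cd).
Qed.

(** * Harnack's inequality *)

Section Harnack.
Variables (g : K -> nat -> R) (E : R).
Hypothesis g_ge0 : forall r k, 0 <= g r k.
Hypothesis g_child : forall r (k : nat) b, g (child r k b) k = g r k.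
Hypothesis g_super : forall r (k : nat),
  g r k + \sum_(b : F) g (child r k.+1 b) k.+2 <= (q%:R + 1) * g r k.+1 + E.

Lemma harnack_step (J : nat) r k : 0 <= E ->
  (geom J.+1)%:R * g r k <=
  (geom J.+2)%:R * g r k.+1 + J.+1%:R * (geom J.+1)%:R * E.
Proof.
move=> E0; elim: J r k => [|J IHJ] r k.
  rewrite geomS [geom 2]geom_rec geomS /geom !big_ord0 !add0n expn0 muln1 !mul1r.
  rewrite natrD [1%:R + _]addrC.
  apply: le_trans (g_super r k); rewrite lerDl; exact: sumr_ge0.
have h : q%:R * ((geom J.+1)%:R * g r k.+1) <=
    (geom J.+2)%:R * (\sum_(b : F) g (child r k.+1 b) k.+2) +
    q%:R * (J.+1%:R * (geom J.+1)%:R * E).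
  have cst x : q%:R * x = \sum_(b : F) x by rewrite sumr_const mulr_natl.
  rewrite !cst mulr_sumr -big_split /=.
  by apply: ler_sum => b _; rewrite -(g_child r k.+1 b); apply: IHJ.
have G2 : 0 <= (geom J.+2)%:R :> R by [].
have := ler_wpM2l G2 (g_super r k).
have e2 : (geom J.+2)%:R = 1 + q%:R * (geom J.+1)%:R :> R.
  by rewrite geom_rec natrD natrM.
have e3 : (geom J.+3)%:R = 1 + q%:R * (geom J.+2)%:R :> R.
  by rewrite geom_rec natrD natrM.
have h3 : q%:R * (J.+1%:R * (geom J.+1)%:R * E) <= J.+1%:R * (geom J.+2)%:R * E.
  rewrite mulrA ler_wpM2r // mulrCA ler_wpM2l // e2 lerDr ler01 //.
rewrite -natr1 e3; move: h h3 e2.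
move: (geom J.+1)%:R (geom J.+2)%:R (\sum_(b : F) _) (g r k) (g r k.+1) => A B S x y.
move=> h h3 e2.
have -> : (1 + q%:R * B) * y = B * ((q%:R + 1) * y) - q%:R * (A * y).
  transitivity ((B - q%:R * A + q%:R * B) * y); last by ring.
  by congr (_ * _); rewrite e2 addrK.
rewrite [_ * (x + S)]mulrDr [_ * (_ + E)]mulrDr [(J.+1%:R + 1) * B]mulrDl mul1r.
rewrite [(_ + B) * E]mulrDl.
lra.
Qed.

Lemma harnack_path r (k : nat) : 0 <= E ->
  g r 0 <= (geom k.+1)%:R * (g r k + k%:R * E).
Proof.
move=> E0; suff h j : (j <= k)%N -> g r (k - j) <= (geom j.+1)%:R * (g r k + j%:R * E).
  by have := h k (leqnn k); rewrite subnn.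
elim: j => [|j IHj] jk.
  by rewrite subn0 mul0r addr0 geomS /geom big_ord0 expn0 mul1r.
have Gp i : 0 < (geom i.+1)%:R :> R by rewrite ltr0n geom_rec.
have := @harnack_step j r (k - j.+1) E0.
rewrite (_ : (k - j.+1).+1 = (k - j)%N); last by lia.
have jg : j.+1%:R <= (geom j.+2)%:R :> R.
  rewrite ler_nat; elim: (j.+1) => // i IHi; rewrite geomS.
  by apply: leq_ltn_trans IHi _; rewrite -[ltnLHS]addn0 ltn_add2l expn_gt0 ltnW ?card_gt1.
move=> h; rewrite -(ler_pM2l (Gp j)); apply: (le_trans h).
apply: (@le_trans _ _ ((geom j.+2)%:R * ((geom j.+1)%:R * (g r k + j%:R * E)) +
   (geom j.+1)%:R * (j.+1%:R * E))).
  by rewrite lerD ?ler_wpM2l ?ler0n ?IHj ?(ltnW jk) // [X in X * E]mulrC mulrA.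
rewrite mulrCA -mulrDr ler_pM2l // -natr1 [in leRHS]mulrDl mul1r addrA [in leRHS]mulrDr.
by rewrite lerD2l ler_wpM2r // natr1.
Qed.

End Harnack.

(** * Coprime pairs and interpolation *)

Lemma uniq_polys_size (N : nat) (s : seq {poly F}) :
  uniq s -> (forall p, p \in s -> (size p <= N)%N) -> (size s <= q ^ N)%N.
Proof.
move=> us hs; have inj : {in s &, injective (@npolyp F N)}.
  move=> x y xs ys /(congr1 (@polyn _ _)).
  by rewrite !npolypK ?hs.
rewrite -(card_npoly F N) -(size_map (@npolyp F N)).
by rewrite -(card_uniqP _) ?max_card // map_inj_in_uniq.
Qed.

Lemma sum_codegree (N : nat) (s : seq {poly F}) :
  uniq s -> (forall p, p \in s -> (size p <= N)%N && (p != 0)) ->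
  (\sum_(p <- s) (N - size p) <= geom N)%N.
Proof.
elim: N s => [|N IHN] s us hs; first by rewrite big1_seq ?leq0n.
rewrite (bigID (fun p : {poly F} => (size p <= N)%N)) /=.
rewrite [X in (_ + X)%N]big1_seq ?addn0; last first.
  by move=> p /andP[pN /hs /andP[pN' _]]; apply/eqP; rewrite subn_eq0 ltnNge.
rewrite -big_filter geomS; set s' := [seq p <- s | _].
have us' : uniq s' by apply: filter_uniq.
have hs' p : p \in s' -> (size p <= N)%N && (p != 0).
  by rewrite mem_filter => /andP[-> /hs /andP[_ ->]].
rewrite (eq_big_seq (fun p : {poly F} => (N - size p) + 1)%N); last first.
  by move=> p /hs' /andP[pN _]; rewrite addn1 subSn.
rewrite big_split leq_add ?IHN // sum1_size.
by apply: uniq_polys_size => // p /hs' /andP[].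
Qed.

(* The fractions d/c with c monic of degree n and deg d < n are encoded as pairs (c, d). *)
Definition monic_pair (n : nat) (x : {poly F} * {poly F}) : bool :=
  [&& x.1 \is monic, size x.1 == n.+1 & (size x.2 <= n)%N].

Definition pair_of (n : nat) (x : {poly_n F} * {poly_n F}) : {poly F} * {poly F} :=
  ('X^n + (x.1 : {poly F}), x.2 : {poly F}).

Definition monic_gcd (c d : {poly F}) := (lead_coef (gcdp c d))^-1 *: gcdp c d.

Lemma pair_of_monic n x : monic_pair n (pair_of (n := n) x).
Proof.
have s1 : (size (x.1 : {poly F}) < size ('X^n : {poly F}))%N.
  by rewrite size_polyXn ltnS size_npoly.
rewrite /monic_pair /= size_npoly andbT monicE lead_coefDl // lead_coefXn eqxx.
by rewrite size_polyDl // size_polyXn eqxx.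
Qed.

Lemma pair_of_inj n : injective (@pair_of n).
Proof. by move=> [a b] [c d] [/addrI /val_inj -> /val_inj ->]. Qed.

Lemma pair_of_onto n x : monic_pair n x -> exists y, x = pair_of (n := n) y.
Proof.
case: x => c d /and3P[/= mc /eqP sc sd].
exists (npolyp n (c - 'X^n), npolyp n d); rewrite /pair_of /= !npolypK //.
  by rewrite addrC subrK.
apply/leq_sizeP => j; rewrite leq_eqVlt coefB coefXn => /orP[/eqP <-|nj].
  by move: mc; rewrite monicE lead_coefE sc eqxx /= => /eqP ->; rewrite subrr.
by rewrite gtn_eqF // subr0 nth_default // sc.
Qed.

Lemma monic_gcdE e c d : e \is monic -> coprimep c d -> monic_gcd (e * c) (e * d) = e.
Proof.
move=> me cop.
have h : gcdp (e * c) (e * d) %= e.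
  rewrite (eqp_ltrans (gcdp_mul2l _ _ _)) -[X in _ %= X]mulr1 eqp_mull //.
  by rewrite gcdp_eqp1.
have g0 : gcdp (e * c) (e * d) != 0.
  by apply: contraTneq h => ->; rewrite eqp_sym eqp0 monic_neq0.
apply/eqP; rewrite -eqp_monic //.
  by apply: eqp_trans h; rewrite eqp_scale // invr_eq0 lead_coef_eq0.
by rewrite monicE lead_coefZ mulVf // lead_coef_eq0.
Qed.

Lemma monic_gcd_decomp c d : c != 0 -> exists c1 d1 : {poly F},
  [/\ c = monic_gcd c d * c1, d = monic_gcd c d * d1, coprimep c1 d1
    & monic_gcd c d \is monic].
Proof.
move=> c0; have g0 : gcdp c d != 0 by rewrite gcdp_eq0 negb_and c0.
have lg0 : lead_coef (gcdp c d) != 0 by rewrite lead_coef_eq0.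
exists (lead_coef (gcdp c d) *: (c %/ gcdp c d)), (lead_coef (gcdp c d) *: (d %/ gcdp c d)).
have E p : gcdp c d %| p ->
    p = monic_gcd c d * (lead_coef (gcdp c d) *: (p %/ gcdp c d)).
  by move=> gp; rewrite -scalerAl -scalerAr scalerA mulVf // scale1r mulrC divpK.
split; first exact/E/dvdp_gcdl; first exact/E/dvdp_gcdr.
  by rewrite coprimepZl // coprimepZr // coprimep_div_gcd // c0.
by rewrite monicE lead_coefZ mulVf.
Qed.

(* A common factor X e + b of positive degree is recovered from b and the pair obtained
   by replacing it with e; hence there are at most q^(2n+1) non-coprime pairs. *)
Lemma noncoprime_pairs n (x : {poly F} * {poly F}) : monic_pair n.+1 x ->
  ~~ coprimep x.1 x.2 -> exists (y : {poly F} * {poly F}) (b : F), monic_pair n y /\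
  let e := monic_gcd y.1 y.2 in
  x = (('X * e + b%:P) * (y.1 %/ e), ('X * e + b%:P) * (y.2 %/ e)).
Proof.
case: x => c d /and3P[/= mc /eqP sc sd] ncop.
have c0 : c != 0 by rewrite -size_poly_eq0 sc.
have [c1 [d1 [Ec Ed cop mg]]] := monic_gcd_decomp d c0.
have sg : (1 < size (monic_gcd c d))%N.
  have g0 : gcdp c d != 0 by rewrite gcdp_eq0 negb_and c0.
  rewrite size_scale ?invr_eq0 ?lead_coef_eq0 //.
  by rewrite ltn_neqAle eq_sym ncop size_poly_gt0.
move: mg sg Ec Ed; set g := monic_gcd c d; clearbody g; elim/poly_ind: g => [|e b _].
  by rewrite size_poly0.
move=> mg sg Ec Ed.
have e0 : e != 0.
  by apply: contraTneq sg => ->; rewrite mul0r add0r -leqNgt size_polyC leq_b1.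
have se : size (e * 'X + b%:P) = (size e).+1 by rewrite size_MXaddC (negPf e0).
have me : e \is monic.
  move: mg; rewrite !monicE !lead_coefE se /= coefD coefMX coefC; move: e0.
  by rewrite -size_poly_gt0; case: (size e) => //= k _; rewrite addr0.
have mc1 : c1 \is monic by move: mc; rewrite Ec monicMl.
have se0 : (0 < size e)%N by rewrite size_poly_gt0.
exists (e * c1, e * d1), b; rewrite /= monic_gcdE // !mulKp //.
split; last by rewrite [in LHS]Ec [in LHS]Ed ['X * e]mulrC.
apply/and3P; split; rewrite /= ?monicMl //.
  by apply/eqP; move: sc; rewrite Ec !size_monicM ?monic_neq0 // se /= => ->.
have [->|d10] := eqVneq d1 0; first by rewrite mulr0 size_poly0.
by move: sd; rewrite Ed !size_monicM // se /= -subn1 leq_subLR add1n.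
Qed.

Lemma coprime_pairs n : exists s : seq ({poly F} * {poly F}),
  [/\ uniq s, (q ^ n.*2.+2 - q ^ n.*2.+1 <= size s)%N &
      forall x, x \in s -> monic_pair n.+1 x && coprimep x.1 x.2].
Proof.
pose N := n.+1; pose T : finType := ({poly_N F} * {poly_N F})%type.
pose T' : finType := (({poly_n F} * {poly_n F}) * F)%type.
pose cop : {set T} := [set x | coprimep (pair_of x).1 (pair_of x).2].
exists [seq pair_of x | x <- enum cop]; split.
- rewrite map_inj_uniq ?enum_uniq //; exact: pair_of_inj.
- rewrite size_map -cardE.
  have cT : #|T| = (q ^ n.*2.+2)%N.
    by rewrite card_prod card_npoly -expnD; congr (_ ^ _)%N; rewrite /N; lia.
  have cT' : #|T'| = (q ^ n.*2.+1)%N.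
    by rewrite !card_prod card_npoly -expnD -expnSr; congr (_ ^ _)%N; lia.
  rewrite -cT leq_subLR -(cardsC cop) addnC leq_add2r -cT'.
  pose psi (y : T') : T :=
    let x := pair_of y.1 in let e := monic_gcd x.1 x.2 in let g := 'X * e + y.2%:P in
    (npolyp N (g * (x.1 %/ e) - 'X^N), npolyp N (g * (x.2 %/ e))).
  apply: (@leq_trans #|psi @: [set: T']|); last by rewrite -cardsT leq_imset_card.
  apply/subset_leq_card/fintype.subsetP => x; rewrite !inE => nx.
  have [y [b [hy hx]]] := noncoprime_pairs (pair_of_monic x) nx.
  have [y' Ey] := pair_of_onto hy; rewrite Ey in hx.
  apply/imsetP; exists (y', b) => //.
  have -> : psi (y', b) = (npolyp N ((pair_of x).1 - 'X^N), npolyp N (pair_of x).2).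
    by rewrite hx.
  case: x {nx hx} => a1 a2; rewrite /pair_of /= addrC addKr.
  by congr (_, _); apply: val_inj; rewrite /= npolypK.
- by move=> x /mapP[y]; rewrite mem_enum inE => hy ->; rewrite pair_of_monic.
Qed.

Lemma lagrange_node (l : nat) (t : 'I_l.+1 -> C) (P : {poly C}) (i : nat) :
  injective t -> (forall j, abs (t j) <= 1) -> (size P <= l.+1)%N ->
  exists j, abs P`_i * \prod_(k | k != j) abs (t j - t k) <= abs P.[t j].
Proof.
move=> inj t1 sP.
pose D j := \prod_(k | k != j) (t j - t k).
have D0 j : D j != 0.
  by apply/prodf_neq0 => k kj; rewrite subr_eq0 eq_sym (inj_eq inj).
pose L j : {poly C} := \prod_(k | k != j) ('X - (t k)%:P).
have L_small j k : abs (L j)`_k <= 1.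
  rewrite /L; elim/big_rec: _ k => [|a p _ IH] k.
    by rewrite coef1; case: eqP => _; rewrite ?abs1 ?abs0 ?ler01.
  rewrite mulrBl coefB coefXM coefCM ultraB //; first by case: eqP; rewrite ?abs0 ?ler01.
  by rewrite a_M mulr_ile1.
pose P' := \sum_j (P.[t j] / D j) *: L j.
have EP : P = P'.
  apply/eqP; rewrite -subr_eq0; apply/eqP.
  apply: (@roots_geq_poly_eq0 _ _ (codom t)).
  - apply/allP => _ /codomP[j ->]; apply/rootP; rewrite hornerD hornerN.
    rewrite horner_sum (bigD1 j) //= big1 => [|k kj].
      rewrite addr0 hornerZ /L horner_prod.
      rewrite (eq_bigr (fun k => t j - t k)) => [|k _]; last by rewrite hornerXsubC.
      by rewrite divfK ?subrr // D0.
    rewrite hornerZ /L horner_prod (bigD1 j) 1?eq_sym //=.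
    by rewrite hornerXsubC subrr mul0r mulr0.
  - by rewrite map_inj_uniq ?enum_uniq.
  rewrite size_codom card_ord (leq_trans (size_polyD _ _)) // geq_max sP size_polyN.
  apply: (leq_trans (size_sum _ _ _)); apply/bigmax_leqP => j _.
  apply: (leq_trans (size_scale_leq _ _)).
  rewrite size_prod => [|k _]; last by rewrite polyXsubC_eq0.
  rewrite (eq_bigr (fun=> 2%N)) => [|k _]; last by rewrite size_XsubC.
  by rewrite sum_nat_const cardC1 card_ord; lia.
have [j _ hj] := arg_maxP (fun j => abs P.[t j] / abs (D j)) (erefl (xpredT (ord0 : 'I_l.+1))).
exists j; rewrite -abs_prod -ler_pdivlMr; last by rewrite abs_gt0; apply: D0.
rewrite {1}EP coef_sum; apply: ultra_sum => [|k _]; first by rewrite divr_ge0.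
rewrite coefZ a_M abs_div; apply: le_trans (hj k isT).
by rewrite ler_piMr ?divr_ge0 ?L_small.
Qed.

(** * Quasi-modular forms *)

Lemma mob_inv a b c d z : a * d - b * c = 1 -> lin c d z != 0 ->
  z = mob d (- b) (- c) a (mob a b c d z) /\
  lin (- c) a (mob a b c d z) = (lin c d z)^-1.
Proof.
move=> det h; have det' : inA a * inA d - inA b * inA c = 1.
  by rewrite -!inA_M -inA_B det inA1.
have E : lin (- c) a (mob a b c d z) = (lin c d z)^-1.
  rewrite lin_mob // -[RHS]mul1r; congr (_ / _).
  have -> : - c * a + a * c = 0 by ring.
  have -> : - c * b + a * d = 1 by rewrite -det; ring.
  by rewrite /lin inA0 inA1 mul0r add0r.
split=> //; rewrite {1}/mob E invrK lin_mob // divfK //.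
have -> : d * a + - b * c = 1 by rewrite -det; ring.
have -> : d * b + - b * d = 0 by ring.
by rewrite /lin inA0 inA1 mul1r addr0.
Qed.

Lemma det_2x2 (T : comNzRingType) (M : 'M[T]_2) :
  \det M = M 0 0 * M 1 1 - M 0 1 * M 1 0.
Proof.
rewrite (expand_det_row _ 0) !big_ord_recl big_ord0 addr0 /cofactor !det_mx11 !mxE /=.
rewrite expr0 mul1r expr1 mulN1r mulrN; congr (_ * _ - _ * _);
  congr (M _ _); exact: val_inj.
Qed.

Lemma poly_translates_eq0 (p : {poly C}) (y : C) :
  (forall d, root p (y + inA d)) -> p = 0.
Proof.
move=> h; pose s := [seq y + inA 'X^k | k <- seq.iota 0 (size p)].
apply: (@roots_geq_poly_eq0 _ p s); last by rewrite size_map size_iota.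
  by apply/allP => x /mapP[k _ ->].
rewrite map_inj_uniq ?iota_uniq // => i j /addrI /eqP.
rewrite -subr_eq0 -inA_B inA_eq0 subr_eq0 => /eqP /(congr1 (size : {poly F} -> nat)).
by rewrite !size_polyXn => -[].
Qed.

Section QuasiModular.
Variables (varpi : C) (w : nat) (m : int) (l : nat) (f : C -> C) (fs : 'I_l.+1 -> C -> C).
Hypothesis data : quasi_modular_data iota abs varpi w m f fs.

Lemma quasi_modular_sl2 a b c d z : Omega z -> a * d - b * c = 1 ->
  f (mob a b c d z) =
  lin c d z ^+ w * \sum_(i < l.+1) fs i z * (inA c / lin c d z) ^+ i.
Proof.
move=> Oz det; case: data => _ _ h.
pose g : 'M[{poly F}]_2 := \matrix_(i, j)
  (if i == 0 then (if j == 0 then a else b) else (if j == 0 then c else d)).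
have g_det : \det g = 1 by rewrite det_2x2 !mxE.
have gu : g \in unitmx by rewrite unitmxE g_det unitr1.
by have := h z g Oz gu; rewrite g_det !mxE /= inA1 exp1rz mulr1.
Qed.

Lemma majorant (B : R) : 0 <= B ->
  (forall i (j : nat) z, fib 0 (- j%:Z) z -> abs (fs i z) <= B) ->
  forall r (k : nat) z, fib r k z -> abs (f z) <= Q ^+ (k * w) * B.
Proof.
move=> B0 hB r k z fz; have Oz := fib_Omega fz.
have [a [b [c [d [j [det fz' hl]]]]]] := reduction fz.
have l0 : lin c d z != 0 by apply: lin_neq0 => //; apply: det_neq0 det.
have [E1 E2] := mob_inv det l0.
set z' := mob a b c d z in fz' E1 E2.
have det' : d * a - (- b) * (- c) = 1 by rewrite -det; ring.
have Oz' := fib_Omega fz'.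
rewrite [in X in X <= _]E1 (quasi_modular_sl2 Oz' det') E2 a_M absX absV.
have al : 0 < abs (lin c d z) by rewrite abs_gt0.
have hl' : Q ^- k <= abs (lin c d z).
  apply: le_trans hl; rewrite le_min exprnN lexx andbT.
  by rewrite -(expr0z Q) Qz_le; lia.
apply: ler_pM; rewrite ?exprn_ge0 ?invr_ge0 ?a_ge0 //.
  rewrite exprM lerXn2r // ?nnegrE ?invr_ge0 ?exprn_ge0 ?a_ge0 ?Q_ge0 //.
  by rewrite invf_ple ?posrE ?exprn_gt0 ?Q_gt0.
apply: ultra_sum => // i _; rewrite a_M -[leRHS]mulr1 ler_pM ?a_ge0 ?(hB i j) //.
rewrite absX exprn_ile1 ?a_ge0 // abs_div -E2.
have [->|c0] := eqVneq c 0; first by rewrite oppr0 inA0 abs0 mul0r.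
have l0' : lin (- c) a z' != 0 by rewrite E2 invr_neq0.
rewrite ler_pdivrMr ?abs_gt0 // mul1r.
have c0' : - c != 0 by rewrite oppr_eq0.
have [s ->] := lin_factor a z' c0'; rewrite a_M ler_peMr ?a_ge0 //.
by apply: le_trans (fz'.2 s); rewrite opprK -(expr0z Q) Qz_le.
Qed.

(* Comparing the expansions of f at y = mob a b c d z and at z gives an identity of
   polynomials in t = y + d' valid for all d' in A; its value at t = 0 is the claim. *)
Lemma leading_transform a b c d z : Omega z -> Omega (mob a b c d z) ->
  a * d - b * c = 1 ->
  fs ord_max (mob a b c d z) * lin c d z ^+ (2 * l) =
  lin c d z ^+ w * fs ord_max z.
Proof.
move=> Oz Oy det; set y := mob a b c d z in Oy *.
have J0 : lin c d z != 0 by apply: lin_neq0 => //; apply: det_neq0 det.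
set J := lin c d z in J0 *.
have ctE t' : inA a + t' * inA c = inA c * (y + t') + J^-1.
  have det' : inA a * inA d - inA b * inA c = 1.
    by rewrite -!inA_M -inA_B det inA1.
  have yJ : y * J = lin a b z by rewrite /y /mob -/J divfK.
  apply: (mulIf J0); rewrite [RHS]mulrDl mulVf //.
  have -> : inA c * (y + t') * J = inA c * (y * J) + inA c * t' * J by ring.
  by rewrite yJ -det' /J /lin; ring.
pose p : {poly C} := \sum_(i < l.+1) fs i y *: 'X^(l - i) -
  (J ^+ w) *: \sum_(i < l.+1) (fs i z / J ^+ i) *:
     ('X^(l - i) * (inA c *: 'X + (J^-1)%:P) ^+ i).
have p0 : p = 0.
  apply: (poly_translates_eq0 (y := y)) => d'; apply/rootP.
  set t := y + inA d'.
  have t0 : t != 0.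
    have [s <-] : exists s, y - iota s = t.
      by exists (- FracField.tofrac d'); rewrite rmorphN opprK.
    exact: Omega_not_K.
  have tE : lin 1 d' y = t by rewrite /lin inA1 mul1r.
  have h1 := @quasi_modular_sl2 0 (-1) 1 d' y Oy.
  have h2 := @quasi_modular_sl2 (- c) (- d) (a + d' * c) (b + d' * d) z Oz.
  have mE : mob 0 (-1) 1 d' y = mob (- c) (- d) (a + d' * c) (b + d' * d) z.
    rewrite /mob tE /t /y /mob -/J /lin !inA_D !inA_M !inA_N inA0 inA1 mul0r add0r.
    have K0 : inA a * z + inA b + inA d' * J != 0.
      have := t0; rewrite /t /y /mob -/J; apply: contraNneq => E.
      by rewrite -(mulfK J0 (inA d')) -mulrDl /lin E mul0r.
    rewrite (_ : (inA a + inA d' * inA c) * z + (inA b + inA d' * inA d) =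
      inA a * z + inA b + inA d' * J); last by rewrite /J /lin; ring.
    have -> : - inA c * z - inA d = - J by rewrite /J /lin; ring.
    by rewrite /lin; field; apply/andP; split; [exact: K0 | exact: J0].
  have l2 : lin (a + d' * c) (b + d' * d) z = J * t.
    rewrite /t /y /mob -/J mulrDr mulrCA divff // mulr1 /J /lin !inA_D !inA_M; ring.
  have {h1 h2} : t ^+ w * \sum_(i < l.+1) fs i y * (1 / t) ^+ i =
      (J * t) ^+ w * \sum_(i < l.+1) fs i z * ((inA c * t + J^-1) / (J * t)) ^+ i.
    rewrite -tE -[X in X / _]inA1 -h1; last by ring.
    rewrite mE h2; last by rewrite -det; ring.
    rewrite l2 tE; congr (_ * _); apply: eq_bigr => i _.
    by rewrite inA_D inA_M ctE.
  rewrite exprMn [J ^+ w * _]mulrC -mulrA => /(mulfI (expf_neq0 w t0)) => h.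
  rewrite /p hornerD hornerN hornerZ !horner_sum; apply/eqP; rewrite subr_eq0; apply/eqP.
  have tl i : (i <= l)%N -> t ^+ l = t ^+ (l - i) * t ^+ i.
    by move=> il; rewrite -exprD subnK.
  have {}h := congr1 ( *%R (t ^+ l)) h; move: h.
  rewrite mulrCA !mulr_sumr => h.
  apply: etrans (etrans h _).
    apply: eq_bigr => i _; rewrite hornerZ hornerXn mulrCA; congr (_ * _).
    have il : (i <= l)%N by rewrite -ltnS.
    by rewrite div1r exprVn (tl _ il) mulfK // expf_neq0.
  apply: eq_bigr => i _; congr (_ * _).
  have il : (i <= l)%N by rewrite -ltnS.
  rewrite hornerZ hornerM hornerXn horner_exp hornerD hornerZ hornerX hornerC.
  rewrite expr_div_n exprMn (tl _ il); move: (expf_neq0 i t0) (expf_neq0 i J0).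
  move: (t ^+ i) (J ^+ i) (t ^+ (l - i)) ((_ + _) ^+ i) (fs i z) => A B D E G A0 B0.
  by field; rewrite A0 B0.
have := congr1 (fun P => P.[0]) p0.
rewrite /p horner0 hornerD hornerN hornerZ !horner_sum !big_ord_recr /=.
rewrite big1 => [|i _]; last first.
  by rewrite hornerZ hornerXn expr0n subn_eq0 leqNgt ltn_ord mulr0.
rewrite big1 => [|i _]; last first.
  by rewrite hornerZ hornerM hornerXn expr0n subn_eq0 leqNgt ltn_ord mul0r mulr0.
rewrite !add0r hornerZ hornerZ hornerM subnn expr0 hornerC horner_exp hornerD hornerZ hornerX hornerC.
rewrite mulr0 add0r mulr1 mul1r => /eqP; rewrite subr_eq0 => /eqP ->.
rewrite mul2n -addnn exprD exprVn; field.
by rewrite expf_neq0.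
Qed.

Lemma fib_inversion z : fib 0 1 z -> fib 0 (- 1) (mob 0 (-1) 1 0 z).
Proof.
move=> fz; have Oz := fib_Omega fz.
have E : mob 0 (-1) 1 0 z = - z^-1.
  by rewrite /mob /lin inA_N inA0 inA1 mul0r add0r mul1r addr0 mulN1r.
have az : abs z = Q^-1.
  have := fib_abs 0 fz; rewrite rmorph0 !subr0 abs0 => ->.
  by rewrite (max_idPl (Qz_ge0 _)).
have z0 : z != 0 by rewrite -abs_gt0 az invr_gt0 Q_gt0.
rewrite E; split.
  by rewrite rmorph0 subr0 absN absV az invrK opprK.
move=> s; rewrite opprK expr1z; have [->|s0] := eqVneq s 0.
  by rewrite rmorph0 subr0 absN absV az invrK.
have is0 : iota s != 0 by rewrite fmorph_eq0.
have -> : - z^-1 - iota s = - (iota s / z) * (z - iota (- s^-1)).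
  by rewrite rmorphN fmorphV; field; rewrite ?is0 ?z0.
rewrite a_M absN abs_div az invrK (fib_abs _ fz) rmorph0 sub0r absN rmorphN absN fmorphV absV.
have as0 : 0 < abs (iota s) by rewrite abs_gt0.
rewrite [abs _ * Q]mulrC -mulrA ler_peMr ?Q_ge0 //.
apply: (@le_trans _ _ (abs (iota s) * (abs (iota s))^-1)).
  by rewrite mulfV // gt_eqF.
by rewrite ler_pM2l // le_max lexx orbT.
Qed.

Section Leading.
Hypothesis per : is_carlitz_period iota abs varpi.
Hypothesis fl_nz : nonzero_on_Omega iota abs (fs ord_max).

Let fs_hol i : holomorphic (fs i). Proof. by case: data => _ /(_ i)[]. Qed.

Let fs_inf i : holomorphic_infty iota abs varpi (fs i).
Proof. by case: data => _ /(_ i)[]. Qed.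

Lemma fs_vertex_le i e (j : nat) z : 0 < e -> fib 0 (- j%:Z) z ->
  abs (fs i z) <= nrm (fs i) e 0 0.
Proof.
move=> e0 fz; apply: (le_trans (nrm_le (fs_hol i) e0 fz)).
rewrite -ler_lg ?nrm_gt0 //; exact: (phi_vertex_le j per (fs_hol i) e0 (fs_inf i)).
Qed.

Lemma leading_nonzero : exists2 z, fib 0 0 z & fs ord_max z != 0.
Proof.
apply: contrapT => nz.
have h0 z : fib 0 0 z -> fs ord_max z = 0.
  by move=> fz; apply/eqP/negPn/negP => z0; apply: nz; exists z.
have hj (j : nat) z : fib 0 (- j%:Z) z -> fs ord_max z = 0.
  move=> fz; apply/eqP; rewrite -abs_eq0b eq_le a_ge0 andbT.
  apply/ler_addgt0Pr => e e0; rewrite add0r.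
  apply: (le_trans (fs_vertex_le _ e0 fz)).
  by apply: nrm_le_bound => // y /h0 ->; rewrite abs0 ltW.
have hall r k z : fib r k z -> fs ord_max z = 0.
  move=> fz; have [a [b [c [d [j [det fy _]]]]]] := reduction fz.
  have := leading_transform (fib_Omega fz) (fib_Omega fy) det.
  rewrite (hj j _ fy) mul0r => /esym/eqP; rewrite mulf_eq0.
  rewrite expf_eq0 (negPf (lin_neq0 (fib_Omega fz) (det_neq0 det))) andbF /=.
  by move/eqP.
case: fl_nz => z Oz; rewrite (holomorphic_identity (fs_hol _) hall Oz).
by rewrite eqxx.
Qed.

(* If w < 2 l, the inversion z -> -1/z makes f_l small at the vertex (0, 1), against
   subharmonicity and the maximality of f_l at (0, 0). *)
Lemma weight_ge : (2 * l <= w)%N.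
Proof.
rewrite leqNgt; apply/negP => wl; have [z0 fz0 nz0] := leading_nonzero.
pose A := abs (fs ord_max z0); have A0 : 0 < A by rewrite abs_gt0.
pose e := A / 2; have e0 : 0 < e by rewrite divr_gt0.
have hf := fs_hol ord_max; have [pf _] := fs_inf ord_max.
set g := fs ord_max in pf hf.
have n00 : A <= nrm g e 0 0 by exact: nrm_le.
have n1 : nrm g e 0 (- 1) <= nrm g e 0 0.
  rewrite -ler_lg ?nrm_gt0 //.
  exact: (phi_vertex_le 1 per hf e0 (fs_inf ord_max)).
have nS : nrm g e 0 1 <= Num.max e (nrm g e 0 (- 1) / Q).
  apply: (nrm_le_bound hf e0) => [|z fz]; rewrite le_max ?lexx //; apply/orP; right.
  have fy := fib_inversion fz.
  have det : 0 * 0 - (-1) * 1 = 1 :> {poly F} by ring.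
  have := leading_transform (fib_Omega fz) (fib_Omega fy) det.
  move=> /(congr1 abs); rewrite !a_M !absX.
  have -> : abs (lin 1 0 z) = Q^-1.
    have := fib_abs 0 fz; rewrite rmorph0 !subr0 abs0 => E.
    by rewrite /lin inA1 inA0 mul1r addr0 E (max_idPl (Qz_ge0 _)).
  rewrite -/g !exprVn => E.
  have gz : abs (g z) = abs (g (mob 0 (-1) 1 0 z)) * (Q ^+ w / Q ^+ (2 * l)).
    have Qw : Q ^+ w != 0 by rewrite expf_neq0 // Q_neq0.
    by rewrite mulrCA E mulrA mulfV // mul1r.
  rewrite gz ler_pM ?a_ge0 ?divr_ge0 ?exprn_ge0 ?Q_ge0 ?(nrm_le hf e0 fy) //.
  rewrite ler_pdivrMr ?exprn_gt0 ?Q_gt0 // mulrC ler_pdivlMr ?Q_gt0 //.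
  by rewrite -exprSr ler_eXn2l ?Q_gt1.
have sub := phi_periodic_subharmonic hf e0 pf 0.
have p1 : phi g e 0 (- 1) <= phi g e 0 0 by rewrite ler_lg ?nrm_gt0.
have : phi g e 0 0 <= phi g e 0 1.
  rewrite -(ler_pM2l (Q_gt0)); move: sub p1; rewrite oppr0 add0r.
  by set P := phi g e 0 0; set P1 := phi g e 0 1; set PN := phi g e 0 (- 1);
    rewrite mulrDl mul1r; lra.
rewrite ler_lg ?nrm_gt0 // => /le_trans /(_ nS); rewrite le_max => /orP[h|h].
  have : A <= A / 2 by apply: le_trans h.
  by lra.
have h2 : nrm g e 0 0 <= nrm g e 0 0 / Q.
  by apply: (le_trans h); rewrite ler_pM2r ?invr_gt0 ?Q_gt0.
move: h2; rewrite ler_pdivlMr ?Q_gt0 // ger_pMr ?nrm_gt0 //.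
by rewrite leNgt Q_gt1.
Qed.

Lemma dominant_coefficient e : 0 < e -> exists i0, forall i,
  nrm (fs i) e 0 0 <= nrm (fs i0) e 0 0.
Proof.
move=> e0; have [i0 _ h] := arg_maxP (fun i => nrm (fs i) e 0 0) (erefl (xpredT (ord0 : 'I_l.+1))).
by exists i0 => i; apply: h.
Qed.

End Leading.

(** * A vertex where the majorant is almost attained *)

Lemma monic_pair_abs n x : monic_pair n x ->
  abs (inA x.1) = Q ^+ n /\ abs (inA x.2) <= Q ^+ n.
Proof.
move=> /and3P[mc /eqP sc sd]; split.
  by rewrite abs_inA ?sc // -size_poly_eq0 sc.
have [->|d0] := eqVneq x.2 0; first by rewrite inA0 abs0 exprn_ge0 ?Q_ge0.
by rewrite abs_inA // ler_eXn2l ?Q_gt1 // (leq_trans (leq_pred _)).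
Qed.

(* The numerators c_k d_j - c_j d_k are distinct nonzero polynomials of degree < 2n, so
   most of them have degree close to 2n. *)
Lemma node_separation n l' (x : 'I_l'.+1 -> {poly F} * {poly F}) j :
  injective x -> (forall k, monic_pair n (x k) && coprimep (x k).1 (x k).2) ->
  Q ^- (l' + geom n.*2) <=
  \prod_(k | k != j) abs (inA (x j).2 / inA (x j).1 - inA (x k).2 / inA (x k).1).
Proof.
move=> inj hx; pose D k := (x k).1 * (x j).2 - (x j).1 * (x k).2.
have c0 k : inA (x k).1 != 0.
  have /andP[/monic_pair_abs[h _] _] := hx k.
  by rewrite -abs_gt0 h exprn_gt0 ?Q_gt0.
have Dinj : injective D.
  move=> k k' /eqP; rewrite -subr_eq0 => /eqP E; apply: inj.
  have {}E : ((x k).1 - (x k').1) * (x j).2 = (x j).1 * ((x k).2 - (x k').2).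
    by apply/eqP; rewrite -subr_eq0; apply/eqP; rewrite -E /D; ring.
  have /andP[/and3P[mk /eqP sk _] _] := hx k.
  have /andP[/and3P[mk' /eqP sk' _] _] := hx k'.
  have /andP[/and3P[mj /eqP sj _] copj] := hx j.
  have e1 : (x k).1 = (x k').1.
    apply/eqP; rewrite -subr_eq0; apply: contraTT isT => ne0.
    have dv : (x j).1 %| (x k).1 - (x k').1.
      by rewrite -(Gauss_dvdpl _ copj) E dvdp_mulr.
    have := dvdp_leq ne0 dv; rewrite sj leqNgt ltnS => /negP[].
    apply/leq_sizeP => i; rewrite leq_eqVlt coefB => /orP[/eqP <-|ni].
      move: mk mk'; rewrite !monicE !lead_coefE sk sk' /= => /eqP -> /eqP ->.
      by rewrite subrr.
    by rewrite !nth_default ?subrr // ?sk ?sk'.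
  have e2 : (x k).2 = (x k').2.
    move/esym/eqP: E; rewrite e1 subrr mul0r mulf_eq0 (negPf (monic_neq0 mj)) /=.
    by rewrite subr_eq0 => /eqP.
  by move: e1 e2; case: (x k) (x k') => ? ? [? ?] /= -> ->.
have Dj : D j = 0 by rewrite /D mulrC subrr.
have D0 k : k != j -> D k != 0 by rewrite -Dj (inj_eq Dinj).
have Ds k : (size (D k) <= n.*2)%N.
  have h i i' : (size ((x i).1 * (x i').2)%R <= n.*2)%N.
    apply: (leq_trans (size_polyMleq _ _)).
    have /andP[/and3P[_ /eqP si _] _] := hx i.
    have /andP[/and3P[_ _ si'] _] := hx i'.
    by rewrite si addSn /= -addnn leq_add2l.
  by rewrite (leq_trans (size_polyD _ _)) // geq_max size_polyN !h.
rewrite (eq_bigr (fun k => Q ^- (1 + (n.*2 - size (D k))))) => [|k kj]; last first.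
  have -> : inA (x j).2 / inA (x j).1 - inA (x k).2 / inA (x k).1 =
      inA (D k) / (inA (x j).1 * inA (x k).1).
    by rewrite /D inA_B !inA_M; field; rewrite !c0.
  have /andP[/monic_pair_abs[hk _] _] := hx k.
  have /andP[/monic_pair_abs[hj _] _] := hx j.
  rewrite abs_div a_M hk hj abs_inA ?D0 // -exprD addnn.
  have sD : (0 < size (D k))%N by rewrite size_poly_gt0 D0.
  rewrite !exprnP exprnN invr_expz -expfzDr ?Q_neq0 //; congr (_ ^ _).
  have := Ds k; lia.
rewrite prodfV -expr_sum.
rewrite lef_pV2 ?posrE ?exprn_gt0 ?Q_gt0 // ler_eXn2l ?Q_gt1 //.
rewrite big_split sum1_card cardC1 card_ord leq_add2l.
rewrite -big_filter -(big_map D xpredT (fun p => n.*2 - size p)%N).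
apply: sum_codegree.
  by rewrite map_inj_uniq // filter_uniq // /index_enum -enumT enum_uniq.
move=> p /mapP[k]; rewrite mem_filter => /andP[kj _] ->.
by rewrite Ds D0.
Qed.

Lemma abs_lin_unit A B z : fib 0 0 z ->
  abs (inA A) <= abs (lin A B z) /\ abs (inA B) <= abs (lin A B z).
Proof.
move=> fz; have z1 : abs z <= 1.
  by have := fz.1; rewrite rmorph0 subr0 oppr0 expr0z.
have hA : abs (inA A) <= abs (lin A B z).
  have [->|A0] := eqVneq A 0; first by rewrite inA0 abs0.
  have [s ->] := lin_factor B z A0; rewrite a_M ler_peMr //.
  by have := fz.2 s; rewrite oppr0 expr0z.
split=> //; have -> : inA B = lin A B z - inA A * z by rewrite /lin addrC addKr.
by apply: ultraB => //; rewrite a_M (le_trans _ hA) // ler_piMr.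
Qed.

Section MobFib.
Variables (n : nat) (a b c d : {poly F}) (z : C).
Hypotheses (fz : fib 0 0 z) (det : a * d - b * c = 1) (cd : monic_pair n (c, d)).

Lemma abs_lin_monic : abs (lin c d z) = Q ^+ n.
Proof.
have [/= hc hd] := monic_pair_abs cd.
have [h _] := abs_lin_unit c d fz.
apply/le_anti; rewrite -{2}hc h andbT ultraD // a_M hc.
rewrite ler_piMr ?exprn_ge0 ?Q_ge0 //.
by have := fz.1; rewrite rmorph0 subr0 oppr0 expr0z.
Qed.

Lemma mob_fib : fib (FracField.tofrac a / FracField.tofrac c) n.*2 (mob a b c d z).
Proof.
have [/= hc hd] := monic_pair_abs cd.
have l0 : lin c d z != 0 by rewrite -abs_gt0 abs_lin_monic exprn_gt0 ?Q_gt0.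
have c0 : inA c != 0 by rewrite -abs_gt0 hc exprn_gt0 ?Q_gt0.
have n2 : Q ^ (- n.*2%:Z) = (Q ^+ n * Q ^+ n)^-1 by rewrite -exprD addnn exprnN.
split.
  rewrite rmorphM fmorphV -!/(Defs.inA iota _).
  have -> : mob a b c d z - inA a / inA c = - (inA c * lin c d z)^-1.
    have E : inA a * inA d - inA b * inA c = 1 by rewrite -!inA_M -inA_B det inA1.
    transitivity (- (inA a * inA d - inA b * inA c) / (inA c * lin c d z)).
      by move: l0; rewrite /mob /lin => l0; field; rewrite c0 l0.
    by rewrite E mulN1r.
  by rewrite absN absV a_M hc abs_lin_monic n2.
move=> s; have [A [B [B0 ->]]] := iota_numden s.
have -> : mob a b c d z - inA A / inA B = lin B (- A) (mob a b c d z) / inA B.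
  by rewrite /lin inA_N; field; rewrite inA_eq0.
rewrite lin_mob // !abs_div abs_lin_monic n2.
set A1 := B * a + _; set B1 := B * b + _.
have hB : B = A1 * d - B1 * c by rewrite -[LHS]mulr1 -det /A1 /B1; ring.
have [h1 h2] := abs_lin_unit A1 B1 fz.
have aB : 0 < abs (inA B) by rewrite abs_gt0 inA_eq0.
have Qn : 0 < Q ^+ n by rewrite exprn_gt0 ?Q_gt0.
rewrite ler_pdivlMr // ler_pdivlMr //.
have -> : (Q ^+ n * Q ^+ n)^-1 * abs (inA B) * Q ^+ n = abs (inA B) / Q ^+ n.
  by field; rewrite gt_eqF.
rewrite ler_pdivrMr // {1}hB inA_B !inA_M ultraB // a_M ler_pM //.
by rewrite hc.
Qed.

End MobFib.

Lemma saturated_vertex n i z : fib 0 0 z ->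
  (l.+1 <= q ^ n.*2.+2 - q ^ n.*2.+1)%N ->
  exists (r : K) z', [/\ abs (iota r) <= 1, fib r n.+1.*2 z' &
    Q ^+ (n.+1 * w) * (abs (fs i z) * Q ^- (l + geom n.+1.*2)) <= abs (f z')].
Proof.
move=> fz ln; have [s [us ss hs]] := coprime_pairs n.
have Oz := fib_Omega fz.
have ls (k : 'I_l.+1) : (k < size s)%N.
  by rewrite (leq_trans (ltn_ord k)) // (leq_trans ln).
pose x (k : 'I_l.+1) := nth (0, 0) s k.
have xinj : injective x.
  by move=> k k' /eqP; rewrite nth_uniq // => /eqP /val_inj.
have hx k : monic_pair n.+1 (x k) && coprimep (x k).1 (x k).2 by rewrite hs // mem_nth.
pose t k := z + inA (x k).2 / inA (x k).1.
have tB j k : t j - t k = inA (x j).2 / inA (x j).1 - inA (x k).2 / inA (x k).1.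
  by rewrite /t opprD addrACA subrr add0r.
have Qp k : 0 < Q ^+ k by rewrite exprn_gt0 ?Q_gt0.
have z1 : abs z <= 1 by have := fz.1; rewrite rmorph0 subr0 oppr0 expr0z.
have sep j : Q ^- (l + geom n.+1.*2) <= \prod_(k | k != j) abs (t j - t k).
  rewrite (eq_bigr (fun k => abs (inA (x j).2 / inA (x j).1 - inA (x k).2 / inA (x k).1))).
    exact: node_separation.
  by move=> k _; rewrite tB.
have tinj : injective t.
  move=> j k E; apply/eqP/negPn/negP => jk; have := sep j.
  rewrite (bigD1 k) 1?eq_sym //= E subrr abs0 mul0r leNgt invr_gt0.
  by rewrite Qp.
have t1 k : abs (t k) <= 1.
  have /andP[/monic_pair_abs[h1 h2] _] := hx k.
  by rewrite /t ultraD // abs_div h1 ler_pdivrMr // mul1r.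
pose P : {poly C} := \sum_(k < l.+1) fs k z *: 'X^(l - k).
have sP : (size P <= l.+1)%N.
  apply: (leq_trans (size_sum _ _ _)); apply/bigmax_leqP => k _.
  by rewrite (leq_trans (size_scale_leq _ _)) // size_polyXn ltnS leq_subr.
have cP : P`_(l - i) = fs i z.
  rewrite /P coef_sum (bigD1 i) //= coefZ coefXn eqxx mulr1 big1 ?addr0 // => k ki.
  rewrite coefZ coefXn; case: eqP => [E|]; last by rewrite mulr0.
  move: ki; rewrite -val_eqE /=; have := ltn_ord k; have := ltn_ord i; lia.
have [j hj] := lagrange_node (l - i) tinj t1 sP; rewrite cP in hj.
have /andP[mj cop] := hx j; have [h1 h2] := monic_pair_abs mj.
move: (erefl (t j)); rewrite {2}/t; case: (x j) mj cop h1 h2 => c d /= mj cop hc hd tE.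
have c0 : inA c != 0 by rewrite -abs_gt0 hc.
have /Bezout_eq1_coprimepP[[u v] /= uv] := cop.
pose a := v %% c; pose b := - u - (v %/ c) * d.
have det : a * d - b * c = 1.
  by rewrite -uv [in RHS](divp_eq v c) /a /b; ring.
have lt : lin c d z = inA c * t j by rewrite tE /lin mulrDr mulrCA divff // mulr1.
have lN := abs_lin_monic fz mj.
have at1 : abs (t j) = 1.
  by apply: (mulfI (lt0r_neq0 (Qp n.+1))); rewrite mulr1 -{1}hc -a_M -lt.
exists (FracField.tofrac a / FracField.tofrac c), (mob a b c d z); split.
- rewrite rmorphM fmorphV -!/(Defs.inA iota _) abs_div ler_pdivrMr ?hc // mul1r.
  have [->|a0] := eqVneq a 0; first by rewrite inA0 abs0 ltW.
  have c00 : c != 0 by rewrite -inA_eq0.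
  rewrite abs_inA // ler_eXn2l ?Q_gt1 //.
  have := ltn_modpN0 v c00; rewrite -/a; case/and3P: mj => _ /eqP /= -> _ h.
  by apply: leq_trans (leq_pred _) _; rewrite -ltnS.
- exact: mob_fib.
rewrite (quasi_modular_sl2 Oz det) a_M absX lN -exprM ler_pM2l //.
have t0 : t j != 0 by rewrite -abs_gt0 at1.
have -> : abs (\sum_(k < l.+1) fs k z * (inA c / lin c d z) ^+ k) = abs P.[t j].
  transitivity (abs (t j ^+ l * (\sum_(k < l.+1) fs k z * (inA c / lin c d z) ^+ k))).
    by rewrite a_M absX at1 expr1n mul1r.
  congr abs; rewrite /P horner_sum mulr_sumr; apply: eq_bigr => k _.
  have -> : inA c / lin c d z = (t j)^-1 by rewrite lt; field; rewrite t0 c0.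
  rewrite hornerZ hornerXn exprVn mulrCA; congr (_ * _).
  have kl : (k <= l)%N by rewrite -ltnS.
  by rewrite -{1}(subnK kl) exprD mulfK // expf_neq0.
by apply: le_trans hj; rewrite ler_wpM2l.
Qed.

(** * The bound on the vanishing order *)

Lemma quasi_modular_holomorphic : holomorphic f.
Proof. by case: data. Qed.

Lemma quasi_modular_periodic : A_periodic iota abs f.
Proof.
have h z a : Omega z -> f (z + inA a) = fs ord0 z.
  move=> Oz; have det : 1 * 1 - a * 0 = 1 :> {poly F} by ring.
  have := quasi_modular_sl2 Oz det.
  rewrite /mob /lin inA1 inA0 mul1r mul0r add0r divr1 => ->.
  rewrite expr1n mul1r big_ord_recl big1 ?addr0 ?expr0 ?mulr1 // => i _.
  by rewrite mul0r expr0n mulr0.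
by move=> z a Oz; rewrite h // -[in RHS](addr0 z) -inA0 h.
Qed.

(* The Harnack constant of a path of length 2(n+1), times the deficiency at its end plus
   the accumulated failure w (q - 1) of superharmonicity at each step. *)
Definition deficiency_bound (n : nat) : R :=
  (geom n.+1.*2.+1)%:R *
  ((n.+1 * w)%:R + (l + geom n.+1.*2)%:R + n.+1.*2%:R * (w%:R * (q%:R - 1))).

Section Bound.
Hypothesis per : is_carlitz_period iota abs varpi.
Hypothesis fl_nz : nonzero_on_Omega iota abs (fs ord_max).
Hypothesis varpi0 : varpi != 0.

Lemma deficiency n z0 (e : R) : (l.+1 <= q ^ n.*2.+2 - q ^ n.*2.+1)%N ->
  fib 0 0 z0 -> 0 < e < abs (fs ord_max z0) ->
  exists B, [/\ abs (fs ord_max z0) <= B, lg B - phi f e 0 0 <= deficiency_bound n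
    & phi f e 0 1 <= lg B + w%:R].
Proof.
move=> hl fz0 /andP[e0 ez0].
have hf := quasi_modular_holomorphic.
have hfs i : holomorphic (fs i) by case: data => _ /(_ i)[].
have [i0 hi0] := dominant_coefficient e0.
pose B := nrm (fs i0) e 0 0.
have AB : abs (fs ord_max z0) <= B by apply: le_trans (hi0 ord_max); apply: nrm_le.
have eB : e < B by apply: lt_le_trans AB.
have B0 : 0 < B by apply: lt_trans eB.
have [z fz Ez] : exists2 z, fib 0 0 z & abs (fs i0 z) = B.
  have [z fz E] := nrm_attained (hfs i0) e0 0 0; exists z => //.
  by move: eB; rewrite -/B in E; rewrite E lt_max ltxx orbF => /ltW /max_idPl ->.
have fle r (k : nat) y : fib r k y -> abs (f y) <= Q ^+ (k * w) * B.
  apply: (majorant (ltW B0)) => i j x fx.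
  exact: (le_trans (fs_vertex_le per i e0 fx)).
pose g r (k : nat) := lg B + (k * w)%:R - phi f e r k.
have lgQB (k : nat) : lg (Q ^+ k * B) = lg B + k%:R.
  by rewrite lgM ?exprn_gt0 ?Q_gt0 // addrC; congr (_ + _); apply: (lgQz k%:Z).
have phile r (k : nat) : phi f e r k <= lg B + (k * w)%:R.
  rewrite -lgQB; apply: phi_le => //; last exact: fle.
    by rewrite mulr_gt0 ?exprn_gt0 ?Q_gt0.
  by rewrite (le_trans (ltW eB)) // ler_peMl ?(ltW B0) // exprn_ege1 ?ltW ?Q_gt1.
exists B; split=> //; last by have := phile 0 1%N; rewrite mul1n.
have g_ge0 r k : 0 <= g r k by rewrite subr_ge0.
have g_child r (k : nat) b : g (child r k b) k = g r k by rewrite /g phi_child.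
have w0 : 0 <= w%:R * (q%:R - 1) :> R.
  by rewrite mulr_ge0 // subr_ge0 ltW // Q_gt1.
have g_super r (k : nat) : g r k + \sum_(b : F) g (child r k.+1 b) k.+2 <=
    (q%:R + 1) * g r k.+1 + w%:R * (q%:R - 1).
  have := phi_subharmonic hf e0 r k.+1.
  rewrite (_ : k.+1%:Z - 1 = k); last by lia.
  rewrite (_ : k.+1%:Z + 1 = k.+2); last by lia.
  rewrite /g sumrB sumr_const -[_ *+ #|_|]mulr_natl.
  set S := \sum_(b : F) _; set p := phi _ _ _ _; set p' := phi _ _ _ _ => h.
  rewrite (_ : #|xpredT : pred F| = q) // !natrM -!natr1.
  by clearbody S p p'; lra.
have [r [z' [r1 fz' hz']]] := saturated_vertex i0 fz hl.
have := harnack_path g_ge0 g_child g_super r n.+1.*2 w0.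
rewrite /g mul0n addr0 (@phi_same _ _ hf e0 r 0 0); last first.
  by rewrite rmorph0 subr0 oppr0 expr0z.
move=> /le_trans; apply; rewrite /deficiency_bound ler_wpM2l // lerD2r.
rewrite Ez in hz'.
have lo : lg B + (n.+1 * w)%:R - (l + geom n.+1.*2)%:R <= phi f e r n.+1.*2.
  have pos : 0 < Q ^+ (n.+1 * w) * (B * Q ^- (l + geom n.+1.*2)).
    by rewrite !mulr_gt0 ?invr_gt0 ?exprn_gt0 ?Q_gt0.
  have f0 := lt_le_trans pos hz'.
  apply: le_trans (phi_ge hf e0 fz' f0).
  rewrite -ler_lg // in hz'; apply: le_trans hz'.
  rewrite mulrA -lgQB [leRHS]lgM ?mulr_gt0 ?invr_gt0 ?exprn_gt0 ?Q_gt0 //.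
  by rewrite lerD2l exprnN lgQz rmorphN.
have : (n.+1.*2 * w)%:R = 2 * (n.+1 * w)%:R :> R by rewrite -mul2n -mulnA natrM.
lra.
Qed.

Lemma vanishing_le n nu a : (l.+1 <= q ^ n.*2.+2 - q ^ n.*2.+1)%N ->
  u_expansion iota abs varpi f a -> (forall i, (i < nu)%N -> a i = 0) ->
  nu%:R <= deficiency_bound n + w%:R.
Proof.
move=> hl ha a0; have hf := quasi_modular_holomorphic.
have pf := quasi_modular_periodic.
have [z0 fz0 nz0] := leading_nonzero per fl_nz.
pose A := abs (fs ord_max z0); have A0 : 0 < A by rewrite abs_gt0.
have [B0 [n0 hB0]] := phi_order varpi0 per hf ha a0.
set D := deficiency_bound n.
have Q1 : 0 < q%:R - 1 :> R by rewrite subr_gt0 Q_gt1.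
have D0 : 0 <= D.
  by rewrite /D /deficiency_bound mulr_ge0 // !addr_ge0 // !mulr_ge0 // ltW.
rewrite leNgt; apply/negP => nuD.
pose X k : R := (q ^ k.+1)%:R / (q%:R - 1).
have nu0 : 0 < nu%:R :> R by apply: le_lt_trans nuD; rewrite addr_ge0.
have key k : (n0 <= k)%N -> B0 - nu%:R * X k < lg A ->
    (nu%:R - D - w%:R) * X k <= B0 + D - lg A.
  move=> n0k hk; pose e := expR ((B0 - nu%:R * X k) * ln q%:R) : R.
  have e0 : 0 < e by apply: expR_gt0.
  have le : lg e = B0 - nu%:R * X k.
    by rewrite /lg expRK mulfK // gt_eqF // lnQ_gt0.
  have eA : e < A by rewrite ltNge -ler_lg // -ltNge le.
  have [|B [AB defB h1]] := deficiency hl fz0 (e := e); first by rewrite e0.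
  have BP : 0 < B by apply: lt_le_trans AB.
  have up := hB0 k e n0k e0 le.
  pose u j := phi f e 0 (- j%:Z).
  have hu j : (q%:R + 1) * u j.+1 <= u j.+2 + q%:R * u j.
    have h := phi_periodic_subharmonic hf e0 pf j.+1.
    rewrite (_ : - j.+1%:Z + 1 = - j%:Z) in h; last by clear; lia.
    exact: h.
  have cg := convex_growth Q_ge0 hu k.
  have h0 : (q%:R + 1) * u 0 <= u 1 + q%:R * phi f e 0 1.
    by have := phi_periodic_subharmonic hf e0 pf 0; rewrite [- 0%:Z + 1]add0r.
  have lAB : lg A <= lg B by rewrite ler_lg.
  have S_le : q%:R * \sum_(i < k) q%:R ^+ i <= X k.
    rewrite /X ler_pdivlMr // natrX exprS.
    have -> : q%:R * (\sum_(i < k) q%:R ^+ i) * (q%:R - 1) =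
        q%:R * (q%:R ^+ k - 1) :> R by rewrite subrX1; ring.
    by rewrite ler_pM2l ?Q_gt0 // lerBlDr lerDl.
  move: up; rewrite le -/(u k); move: cg h0 defB h1 S_le lAB.
  have -> : phi f e 0 0 = u 0 by [].
  move: (u 0) (u 1) (u k) (phi f e 0 1) (lg B) (X k) => u0 u1 uk p1 LB Xk.
  set S := \sum_(i < k) _ => cg h0 defB h1 S_le lAB up.
  have S0 : 0 <= S by apply: sumr_ge0 => i _; apply: exprn_ge0; apply: Q_ge0.
  have du : - (q%:R * (D + w%:R)) <= u1 - u0.
    have h2 := ler_wpM2l (Q_ge0) h1.
    have h3 := ler_wpM2l (Q_ge0) defB.
    by move: h2 h3; rewrite -/D; move: h0; rewrite !mulrDr !mulrDl mulrN; lra.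
  have h4 := ler_wpM2r S0 du.
  have h5 : (D + w%:R) * (q%:R * S) <= (D + w%:R) * Xk.
    by rewrite ler_wpM2l // addr_ge0.
  move: h4 h5 cg defB lAB up; rewrite -/D => h4 h5 cg defB lAB up.
  have h6 : - (q%:R * (D + w%:R)) * S = - ((D + w%:R) * (q%:R * S)) by ring.
  rewrite h6 in h4; rewrite 2!mulrDl !mulNr; move: h5; rewrite mulrDl; lra.
have dn : 0 < nu%:R - D - w%:R by lra.
have [k1 hk1] := Qn_unbounded (`|(B0 - lg A) / nu%:R|).
have [k2 hk2] := Qn_unbounded (`|(B0 + D - lg A) / (nu%:R - D - w%:R)|).
pose k := (n0 + k1 + k2)%N.
have kk1 : (k1 <= k)%N by rewrite /k addnAC leq_addl.
have nk : (n0 <= k)%N by rewrite /k -addnA leq_addr.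
have Xge j : (j <= k)%N -> Q ^+ j <= X k.
  move=> jk; rewrite /X natrX exprSr -mulrA -[leLHS]mulr1 ler_pM ?exprn_ge0 ?Q_ge0 //.
    by rewrite ler_eXn2l ?Q_gt1.
  by rewrite ler_pdivlMr // mul1r lerBlDr lerDl.
have hX1 : (B0 - lg A) / nu%:R < X k.
  apply: (le_lt_trans (ler_norm _)); apply: (lt_le_trans hk1); apply: Xge; exact: kk1.
have hX2 : (B0 + D - lg A) / (nu%:R - D - w%:R) < X k.
  apply: (le_lt_trans (ler_norm _)); apply: (lt_le_trans hk2); apply: Xge; exact: leq_addl.
move: hX1 hX2; rewrite ltr_pdivrMr // [X k * _]mulrC => hX1.
rewrite ltr_pdivrMr // [X k * _]mulrC ltNge key //.
by rewrite ltrBlDr -ltrBlDl.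
Qed.

End Bound.

End QuasiModular.

(* n + 1 is the least degree providing l + 1 nodes. *)
Lemma node_degree l : (0 < l)%N -> exists n, [/\ (l.+1 <= q ^ n.*2.+2 - q ^ n.*2.+1)%N,
  (q ^ n.*2.+2 <= 2 * q ^ 2 * l)%N & n = 0%N \/ (q ^ n.*2.-1 <= l)%N].
Proof.
move=> l0; have q1 := card_gt1.
pose P n := (l < q ^ n.*2.+1 * q.-1)%N.
have Pex : exists n, P n.
  exists l; rewrite /P; apply: (@leq_trans (q ^ l)); first exact: ltn_expl.
  by rewrite -[leqLHS]muln1 leq_mul ?leq_exp2l //; lia.
have PE n : (q ^ n.*2.+2 - q ^ n.*2.+1 = q ^ n.*2.+1 * q.-1)%N.
  by rewrite [in X in (X - _)%N]expnSr -[X in (_ - X)%N]muln1 -mulnBr subn1.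
case: (ex_minnP Pex) => n Pn nmin; exists n; split; first by rewrite PE.
  case: n nmin {Pn} => [|n] nmin.
    by rewrite double0 -[leqLHS]mul1n -mulnA leq_mul // -[leqLHS]muln1 leq_mul.
  have : ~~ P n by apply/negP => /nmin; rewrite ltnn.
  rewrite /P -leqNgt doubleS => h.
  have -> : (q ^ n.*2.+4 = q ^ 2 * (q ^ n.*2.+1 * q))%N by rewrite -expnSr -expnD.
  rewrite [X in (_ <= X * _)%N]mulnC -mulnA leq_mul //.
  apply: (@leq_trans (2 * (q ^ n.*2.+1 * q.-1))); last by rewrite leq_mul.
  by rewrite mulnCA leq_mul //; lia.
case: n nmin {Pn} => [|n] nmin; [by left | right].
have : ~~ P n by apply/negP => /nmin; rewrite ltnn.
rewrite /P -leqNgt doubleS => h; apply: leq_trans h.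
by rewrite -[leqLHS]muln1 leq_mul //; lia.
Qed.

Lemma arithmetic_bound (z x y N L g g' : R) : 2 <= z -> 1 <= x -> 2 * x <= y ->
  1 <= L -> 0 <= N <= 2 * L -> 0 <= g <= 4 * z ^+ 2 * x -> g' <= 4 * z * x ->
  g * (N * y + (x + g') + 2 * N * (y * (z - 1))) + y <=
  252 * z * (z ^+ 2 - 1) * x * (y - x) * L.
Proof.
move=> z2 x1 xy L1 /andP[N0 NL] /andP[g0 gz] gz'.
pose W := y - x; have yW : y = W + x by rewrite subrK.
have xW : x <= W by rewrite /W; lra.
have W1 : 1 <= W by apply: le_trans xW.
pose T := W * L; have WT : W <= T by rewrite ler_peMr //; lra.
have T1 : 1 <= T by apply: le_trans WT.
have Ny : N * y <= 4 * T.
  have -> : 4 * T = 2 * L * (2 * W) by rewrite /T; ring.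
  by apply: ler_pM; rewrite ?N0 //; lra.
have inner : N * y + (x + g') + 2 * N * (y * (z - 1)) <= 12 * z * T.
  have h1 : N * y * (z - 1) <= 4 * T * (z - 1) by rewrite ler_wpM2r //; lra.
  have h2 : z * x <= z * T by rewrite ler_wpM2l //; lra.
  have -> : 2 * N * (y * (z - 1)) = 2 * (N * y * (z - 1)) by ring.
  lra.
have h3 : g * (N * y + (x + g') + 2 * N * (y * (z - 1))) <= 48 * z ^+ 3 * (x * T).
  have -> : 48 * z ^+ 3 * (x * T) = (4 * z ^+ 2 * x) * (12 * z * T) by ring.
  have zT : 0 <= 12 * z * T by rewrite !mulr_ge0 //; lra.
  apply: (@le_trans _ _ (g * (12 * z * T))); first by rewrite ler_wpM2l.
  by rewrite ler_wpM2r.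
have xT : T <= x * T by rewrite ler_peMl //; lra.
have -> : 252 * z * (z ^+ 2 - 1) * x * (y - x) * L = (252 * z * (z ^+ 2 - 1)) * (x * T).
  by rewrite /T /W; ring.
apply: (@le_trans _ _ ((48 * z ^+ 3 + 2) * (x * T))).
  by rewrite [leRHS]mulrDl lerD //; lra.
rewrite ler_wpM2r //; first by lra.
have z3 : 4 * z <= z ^+ 3.
  rewrite (_ : z ^+ 3 = z ^+ 2 * z); last by ring.
  rewrite ler_wpM2r //; first by lra.
  by rewrite (_ : 4 = 2 ^+ 2); [rewrite lerXn2r // nnegrE; lra | ring].
have -> : 252 * z * (z ^+ 2 - 1) = 252 * z ^+ 3 - 252 * z by ring.
lra.
Qed.

Lemma deficiency_bound_le w l n (Lam : R) : (0 < l)%N -> (2 * l <= w)%N ->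
  (q ^ n.*2.+2 <= 2 * q ^ 2 * l)%N -> 1 <= Lam -> n.+1%:R <= 2 * Lam ->
  deficiency_bound w l n + w%:R <=
  252 * Q * (Q ^+ 2 - 1) * l%:R * (w%:R - l%:R) * Lam.
Proof.
move=> l0 lw hq L1 nL; have q1 := card_gt1.
have G1 : (geom n.+1.*2.+1 <= 4 * q ^ 2 * l)%N.
  have h := predq_geom n.+1.*2.+1.
  have : (q.-1 * geom n.+1.*2.+1 <= q.-1 * (4 * q ^ 2 * l))%N.
    rewrite h; apply: (leq_trans (leq_pred _)); rewrite expnS doubleS.
    apply: (leq_trans (leq_mul (leqnn q) hq)).
    rewrite (_ : q * (2 * q ^ 2 * l) = q * 2 * (q ^ 2 * l))%N; last by lia.
    rewrite (_ : q.-1 * (4 * q ^ 2 * l) = q.-1 * 4 * (q ^ 2 * l))%N; last by lia.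
    by rewrite leq_mul //; lia.
  by rewrite leq_pmul2l //; lia.
have G2 : (geom n.+1.*2 <= 4 * q * l)%N.
  have h := predq_geom n.+1.*2.
  have : (q.-1 * geom n.+1.*2 <= q.-1 * (4 * q * l))%N.
    rewrite h; apply: (leq_trans (leq_pred _)); rewrite doubleS.
    apply: (leq_trans hq).
    rewrite (_ : 2 * q ^ 2 * l = q * 2 * (q * l))%N; last by rewrite expnS expn1; lia.
    rewrite (_ : q.-1 * (4 * q * l) = q.-1 * 4 * (q * l))%N; last by lia.
    by rewrite leq_mul //; lia.
  by rewrite leq_pmul2l //; lia.
have {}G1 : (geom n.+1.*2.+1)%:R <= 4 * Q ^+ 2 * l%:R :> R.
  by rewrite -natrX -!natrM ler_nat.
have {}G2 : (geom n.+1.*2)%:R <= 4 * Q * l%:R :> R by rewrite -!natrM ler_nat.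
have l1 : 1 <= l%:R :> R by rewrite ler1n.
have w2 : 2 * l%:R <= w%:R :> R by rewrite -natrM ler_nat.
have Q2 : 2 <= Q by rewrite ler_nat.
rewrite /deficiency_bound !natrM -mul2n natrM natrD.
move: G1 G2 nL l1 w2 Q2 L1; rewrite -mul2n.
by move=> G1 G2 nL l1 w2 Q2 L1; apply: arithmetic_bound; rewrite ?ler0n.
Qed.

Lemma vanishing_order_le varpi w m l f a : (0 < l)%N ->
  is_carlitz_period iota abs varpi -> nonzero_on_Omega iota abs f ->
  quasi_modular_of_depth iota abs varpi w m l f -> u_expansion iota abs varpi f a ->
  exists2 n : nat, is_vanishing_order a n &
    n%:R <= 252 * Q * (Q ^+ 2 - 1) * l%:R * (w%:R - l%:R) *
            Num.max 1 (ln (w%:R - l%:R) / ln Q).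
Proof.
move=> l0 per [z0 Oz0 fz0] [fs data fl_nz] ha.
set bound := (252 * _ * _ * _ * _ * _).
have lw := weight_ge data per fl_nz.
have [n [hn hq nl]] := node_degree l0.
have W1 : l%:R <= w%:R - l%:R :> R.
  by rewrite lerBrDr -natrD ler_nat addnn -mul2n.
have l1 : 1 <= l%:R :> R by rewrite ler1n.
have nL : n.+1%:R <= 2 * Num.max 1 (lg (w%:R - l%:R)).
  case: nl => [->|nl].
    apply: (@le_trans _ _ (2 * 1)); first by rewrite mulr1 ler_nat.
    by rewrite ler_wpM2l // le_max lexx.
  have [->|n0] := posnP n.
    apply: (@le_trans _ _ (2 * 1)); first by rewrite mulr1 ler_nat.
    by rewrite ler_wpM2l // le_max lexx.
  apply: (@le_trans _ _ (2 * n.*2.-1%:R)); first by rewrite -natrM ler_nat; lia.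
  rewrite ler_wpM2l // le_max; apply/orP; right.
  rewrite -[leLHS](lgQz n.*2.-1%:Z) ler_lg ?exprn_gt0 ?Q_gt0 //; last by lra.
  by apply: le_trans W1; rewrite -exprnP -natrX ler_nat.
have bound_ge : deficiency_bound w l n + w%:R <= bound.
  by apply: deficiency_bound_le => //; rewrite le_max lexx.
have bound0 : 0 <= bound.
  apply: le_trans bound_ge; rewrite addr_ge0 // mulr_ge0 // !addr_ge0 // !mulr_ge0 //.
  by rewrite subr_ge0 ltW // Q_gt1.
have [v0|v0] := eqVneq varpi 0.
  exists 0%N => //; split=> //; rewrite v0 in ha.
  by rewrite -(u_expansion_period0 ha Oz0).
have nu_le nu : (forall i, (i < nu)%N -> a i = 0) -> nu%:R <= bound.
  by move=> a0; apply: le_trans bound_ge; apply: (vanishing_le data per fl_nz v0 hn ha a0).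
have ex : exists n, a n != 0.
  apply: contrapT => /forallNP a0.
  have : (Num.bound bound)%:R <= bound by apply: nu_le => i _; apply/eqP/negPn/negP/a0.
  by rewrite leNgt archi_boundP.
case: (ex_minnP ex) => nu anu numin.
have nu0 i : (i < nu)%N -> a i = 0.
  by move=> inu; apply/eqP/negPn/negP => /numin; rewrite leqNgt inu.
by exists nu; [split | apply: nu_le].
Qed.

End ValuedFieldTheory.

Unset Implicit Arguments.
Set Strict Implicit.
Set Printing Implicit Defensive.

Theorem theorem1p2 (R : realType) (p e : nat) (hp : prime p) (he : (1 <= e)%N) :
  let q := (p ^ e)%N in
  (exists2 c : R, 0 < c & vanishing_bound q c) /\
  vanishing_bound q (252 * q%:R * (q%:R ^+ 2 - 1) : R).
Proof.
move=> q; have bound : vanishing_bound q (252 * q%:R * (q%:R ^+ 2 - 1) : R).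
  move=> F Fq C iota abs HC varpi per w m l f l0 f_nz f_qm a fa.
  rewrite -Fq; exact: (vanishing_order_le HC l0 per f_nz f_qm fa).
split; last exact: bound.
exists (252 * q%:R * (q%:R ^+ 2 - 1)); last exact: bound.
have q1 : (1 < q)%N by rewrite -(exp1n e) ltn_exp2r ?prime_gt1.
apply: mulr_gt0; last by rewrite subr_gt0 exprn_egt1 ?ltr1n.
by apply: mulr_gt0; [exact: ltr0Sn | rewrite ltr0n ltnW].
Qed.
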